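(* Let $G$ be a finitely generated group and let $H \leq G$ be a finitely generated subgroup such that $H \backslash G$ is narrow and has at least two ends. Then the following statements are equivalent: (1) $H$ is a virtual fiber subgroup of $G$; (2) $H$ is separable in $G$; (3) $H$ has bounded packing in $G$; (4) there are infinitely many distinct double cosets $HgH$, $g \in G$.
   Context: For a finite generating set $S$ of $G$, $\mathrm{Cay}(G,S)$ is the Cayley graph and $H\backslash \mathrm{Cay}(G,S)$ is the quotient graph by the left action of $H$ (the Schreier coset graph of $H$), with vertex set $H\backslash G$ and path metric in which each edge has length 1. ''$H\backslash G$ has at least two ends'' means this graph has at least two ends (the property is independent of $S$). A subset $Z$ of the vertex set of a connected graph $Y$ (with path metric $d$) is $\mu$-coarsely connected ($\mu\ge 1$) if any two $z,z'\in Z$ are joined by a sequence $z=z_0,\dots,z_n=z'$ in $Z$ with $d(z_i,z_{i+1})\le\mu$. An unbounded connected graph $Y$ is narrow if for each $\mu\ge1$ there is $L(\mu)\ge1$ such that whenever $Y_1,\dots,Y_{L(\mu)+1}$ are unbounded $\mu$-coarsely connected subsets of the vertex set, there are $i\ne j$ with $Y_i\cap Y_j\neq\emptyset$. $H\backslash G$ is narrow if $H\backslash\mathrm{Cay}(G,S)$ is narrow for some (equivalently every) finite generating set $S$. $H\le G$ is a virtual fiber subgroup if $H$ is finitely generated and there are finite index subgroups $G'\le G$, $H'\le H$ with $H'\trianglelefteq G'$ and $G'/H'\cong\mathbb Z$. $H$ is separable if for every $g\in G\setminus H$ there is a finite index subgroup $K\le G$ with $H\le K$ and $g\notin K$. $H$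 has bounded packing if, for a fixed word metric $d_S$ on $G$ ($S$ finite generating set), for every $D\ge0$ there is $R_D\ge0$ such that any set of $R_D+1$ left cosets of $H$ contains two cosets $gH,g'H$ with $d_S(gH,g'H)>D$. *)

(* Defs.v *)
From Stdlib Require Import ZArith List Arith.
Import ListNotations.
Set Implicit Arguments.

Record Group := {
  gcar :> Type;
  gmul : gcar -> gcar -> gcar;
  gone : gcar;
  ginv : gcar -> gcar;
  gassoc : forall x y z, gmul x (gmul y z) = gmul (gmul x y) z;
  gone_l : forall x, gmul gone x = x;
  ginv_l : forall x, gmul (ginv x) x = gone
}.

Arguments gmul {g}.
Arguments gone {g}.
Arguments ginv {g}.

Section GroupDefs.
Context {G : Group}.

Definition is_subgroup (K : G -> Prop) : Prop :=
  K gone /\ (forall x y, K x -> K y -> K (gmul x y)) /\ (forall x, K x -> K (ginv x)).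

Definition wprod (w : list G) : G := fold_right gmul gone w.

Definition letter (S : list G) (a : G) : Prop :=
  In a S \/ exists s, In s S /\ a = ginv s.

Definition generates (S : list G) : Prop :=
  forall g : G, exists w, Forall (letter S) w /\ g = wprod w.

Definition fin_gen_subgroup (K : G -> Prop) : Prop :=
  exists T : list G, Forall K T /\
    forall h, K h <-> exists w, Forall (letter T) w /\ h = wprod w.

Definition wdist_le (S : list G) (g g' : G) (n : nat) : Prop :=
  exists w, Forall (letter S) w /\ length w <= n /\ gmul g (wprod w) = g'.

(** right cosets Hx (vertices of the Schreier coset graph H\Cay(G,S)) *)
Definition same_rcoset (H : G -> Prop) (x y : G) : Prop := H (gmul x (ginv y)).

(** distance in H\Cay(G,S) (edges Hx -- Hxs, s ∈ S^{±1}) : d(Hx, Hy) <= n *)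
Definition cdist_le (H : G -> Prop) (S : list G) (x y : G) (n : nat) : Prop :=
  exists w h, Forall (letter S) w /\ length w <= n /\ H h /\
    gmul x (wprod w) = gmul h y.

(** subsets of the vertex set H\G, represented by H-saturated predicates on G *)
Definition saturated (H : G -> Prop) (Z : G -> Prop) : Prop :=
  forall h g, H h -> Z g -> Z (gmul h g).

Definition finite_vset (H : G -> Prop) (Z : G -> Prop) : Prop :=
  exists l : list G, forall z, Z z -> exists x, In x l /\ same_rcoset H z x.

Definition bounded_vset (H : G -> Prop) (S : list G) (Z : G -> Prop) : Prop :=
  exists x n, forall z, Z z -> cdist_le H S x z n.

Definition unbounded_vset H S Z : Prop := ~ bounded_vset H S Z.

Inductive coarse_chain (H : G -> Prop) (S : list G) (Z : G -> Prop) (mu : nat)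
  : G -> G -> Prop :=
| cc_refl : forall z, Z z -> coarse_chain H S Z mu z z
| cc_step : forall z y z', Z z -> cdist_le H S z y mu ->
    coarse_chain H S Z mu y z' -> coarse_chain H S Z mu z z'.

Definition coarsely_connected H S (mu : nat) (Z : G -> Prop) : Prop :=
  forall z z', Z z -> Z z' -> coarse_chain H S Z mu z z'.

Definition narrow (H : G -> Prop) (S : list G) : Prop :=
  forall mu : nat, 1 <= mu ->
    exists L : nat, 1 <= L /\
      forall Y : nat -> (G -> Prop),
        (forall i, i <= L -> saturated H (Y i) /\ unbounded_vset H S (Y i)
                             /\ coarsely_connected H S mu (Y i)) ->
        exists i j, i <= L /\ j <= L /\ i <> j /\ exists g, Y i g /\ Y j g.

Definition outside (H : G -> Prop) (K : list G) (v : G) : Prop :=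
  forall k, In k K -> ~ same_rcoset H v k.

Inductive conn_avoid (H : G -> Prop) (S : list G) (K : list G) : G -> G -> Prop :=
| ca_refl : forall u, outside H K u -> conn_avoid H S K u u
| ca_step : forall u v w, outside H K u -> cdist_le H S u v 1 ->
    conn_avoid H S K v w -> conn_avoid H S K u w.

Definition at_least_two_ends (H : G -> Prop) (S : list G) : Prop :=
  exists (K : list G) (u v : G),
    outside H K u /\ outside H K v /\ ~ conn_avoid H S K u v /\
    ~ finite_vset H (conn_avoid H S K u) /\
    ~ finite_vset H (conn_avoid H S K v).

Definition finite_index_in (A K : G -> Prop) : Prop :=
  exists l : list G, forall a, A a -> exists x, In x l /\ K (gmul (ginv x) a).

Definition virtual_fiber (H : G -> Prop) : Prop :=
  fin_gen_subgroup H /\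
  exists G' H' : G -> Prop,
    is_subgroup G' /\ finite_index_in (fun _ => True) G' /\
    is_subgroup H' /\ (forall x, H' x -> H x) /\ finite_index_in H H' /\
    (forall x, H' x -> G' x) /\
    (forall x g, H' x -> G' g -> H' (gmul (ginv g) (gmul x g))) /\
    (* G'/H' ≅ Z : a surjective homomorphism G' -> Z with kernel H' *)
    exists phi : G -> Z,
      (forall x y, G' x -> G' y -> phi (gmul x y) = (phi x + phi y)%Z) /\
      (forall z : Z, exists x, G' x /\ phi x = z) /\
      (forall x, G' x -> (phi x = 0%Z <-> H' x)).

Definition separable (H : G -> Prop) : Prop :=
  forall g, ~ H g -> exists K : G -> Prop,
    is_subgroup K /\ finite_index_in (fun _ => True) K /\
    (forall h, H h -> K h) /\ ~ K g.

Definition lcoset_dist_le (H : G -> Prop) (S : list G) (g g' : G) (D : nat) : Prop :=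
  exists h h', H h /\ H h' /\ wdist_le S (gmul g h) (gmul g' h') D.

Definition same_lcoset (H : G -> Prop) (x y : G) : Prop := H (gmul (ginv x) y).

Definition bounded_packing (H : G -> Prop) (S : list G) : Prop :=
  forall D : nat, exists R : nat,
    forall g : nat -> G,
      (forall i j, i <= R -> j <= R -> i <> j -> ~ same_lcoset H (g i) (g j)) ->
      exists i j, i <= R /\ j <= R /\ i <> j /\ ~ lcoset_dist_le H S (g i) (g j) D.

Definition in_dcoset (H : G -> Prop) (x g : G) : Prop :=
  exists h h', H h /\ H h' /\ g = gmul h (gmul x h').

Definition infinitely_many_dcosets (H : G -> Prop) : Prop :=
  ~ exists l : list G, forall g, exists x, In x l /\ in_dcoset H x g.

End GroupDefs.

(* Main.v *)
Require Import Defs.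
From Stdlib Require Import ZArith List Arith Lia Permutation.
From Stdlib Require Import Classical ClassicalEpsilon FunctionalExtensionality PropExtensionality.
Import ListNotations.

(** (1) => (2): for large [M] the subgroup [{x in G' | M divides phi x}] contains [H'], so it has
    finitely many [H]-conjugates; multiplying their intersection by [H] gives a finite-index
    subgroup avoiding a prescribed element.  (2) => (3): a finite-index subgroup containing [H]
    but no element of [B(D) \ H] separates distinct cosets at distance at most [D].
    (3) => (4): finitely many double cosets put all left cosets at bounded distance.

    (4) => (1): for a finitely generated subgroup [Q] the [Q]-orbits on [H\G] are uniformly
    coarsely connected, so narrowness bounds the number of infinite ones.  With [Q = H], all but
    finitely many double cosets lie in the commensurator [C] of [H], so [C/H] is infinite.  The
    translates under [C] of a connected transversal of [C\G] are disjoint in [H\G], so [C] has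
    finite index in [G].  Thus [C] reaches deep into two ends, and a ping-pong argument on the
    two sides of a connected neighbourhood of [H] yields [t] in [C] no positive power of which
    lies in [H].  With [Q = <t>], the space [H\C] is a finite union of [t]-lines; [C] acts on it
    preserving or exchanging its two ends.  On the subgroup preserving them, counting the cosets
    carried across the middle is a homomorphism to [Z], trivial on [H] because [H] has finite
    orbits, and positive on [t].  Its kernel contains a finite-index subgroup [H0] of [H] with
    finite index and is finitely generated, so some power of [t] normalises [H0]. *)

Declare Scope group_scope.
Infix "**" := gmul (at level 40, left associativity) : group_scope.
Notation "x ^-1" := (ginv x) (at level 3, left associativity, format "x ^-1") : group_scope.
Open Scope group_scope.

(** * Groups, words and finiteness *)

Section Basics.
Context {G : Group}.
Implicit Types x y z : G.

Lemma ginv_r x : x ** x^-1 = gone.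
Proof.
  rewrite <- (gone_l G (x ** x^-1)), <- (ginv_l G (x^-1)) at 1.
  rewrite <- gassoc, (gassoc G (x^-1) x), ginv_l, gone_l. apply ginv_l.
Qed.

Lemma gone_r x : x ** gone = x.
Proof. rewrite <- (ginv_l G x), gassoc, ginv_r. apply gone_l. Qed.

Lemma gassoc_r x y z : x ** y ** z = x ** (y ** z).
Proof. symmetry; apply gassoc. Qed.

Lemma gmulKV x y : x ** (x^-1 ** y) = y.
Proof. rewrite gassoc, ginv_r. apply gone_l. Qed.

Lemma gmulVK x y : x^-1 ** (x ** y) = y.
Proof. rewrite gassoc, ginv_l. apply gone_l. Qed.

Lemma ginv_unique x y : x ** y = gone -> y = x^-1.
Proof. intros E. rewrite <- (gmulVK x y), E. apply gone_r. Qed.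

Lemma ginv_mul x y : (x ** y)^-1 = y^-1 ** x^-1.
Proof. symmetry; apply ginv_unique. now rewrite gassoc_r, gmulKV, ginv_r. Qed.

Lemma ginvK x : (x^-1)^-1 = x.
Proof. symmetry; apply ginv_unique. apply ginv_l. Qed.

Lemma ginv1 : (gone : G)^-1 = gone.
Proof. symmetry; apply ginv_unique. apply gone_l. Qed.

End Basics.

Create HintDb grp.
#[global] Hint Rewrite @gassoc_r @gone_l @gone_r @ginv_l @ginv_r @gmulKV @gmulVK
  @ginv_mul @ginvK @ginv1 : grp.
Ltac grp := autorewrite with grp; try reflexivity.

Section Subgroups.
Context {G : Group}.

Lemma sg1 (K : G -> Prop) : is_subgroup K -> K gone.
Proof. now intros []. Qed.

Lemma sgM (K : G -> Prop) : is_subgroup K -> forall x y, K x -> K y -> K (x ** y).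
Proof. now intros [? []]. Qed.

Lemma sgV (K : G -> Prop) : is_subgroup K -> forall x, K x -> K (x^-1).
Proof. now intros [? []]. Qed.

End Subgroups.

Ltac mem :=
  repeat first [ assumption | solve [auto 3]
  | match goal with
    | HK : is_subgroup ?K |- ?K (_ ** _) => apply (sgM K HK)
    | HK : is_subgroup ?K |- ?K (_^-1) => apply (sgV K HK)
    | HK : is_subgroup ?K |- ?K gone => apply (sg1 K HK)
    end ].

(* Proves [K x] through an expression [e] equal to [x], assembled from elements already known to
   satisfy [K]; the equality is left to the rewriting tactic [grp]. *)
Tactic Notation "mem_as" uconstr(e) :=
  match goal with |- ?K ?x => refine (eq_ind e K _ x _); [mem | grp] end.

Section Finiteness.
Context {G : Group}.
Implicit Types (x y z : G) (H K C Z : G -> Prop) (Sg : list G).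

Lemma wprod_app (u v : list G) : wprod (u ++ v) = wprod u ** wprod v.
Proof. induction u as [|a u IH]; simpl; grp. rewrite IH; grp. Qed.

Lemma letter_inv Sg a : letter Sg a -> letter Sg (a^-1).
Proof.
  intros [Ha|[s [Hs ->]]].
  - right; eauto.
  - left; now rewrite ginvK.
Qed.

Lemma letter_in Sg a : letter Sg a <-> In a (Sg ++ map ginv Sg).
Proof.
  unfold letter. rewrite in_app_iff, in_map_iff. split; intros [Ha|[s [? ?]]]; auto; right; exists s; auto.
Qed.

Lemma word_inv Sg w : Forall (letter Sg) w ->
  exists w', Forall (letter Sg) w' /\ length w' = length w /\ wprod w' = (wprod w)^-1.
Proof.
  induction 1 as [|a w Ha Hw [w' [F [L E]]]].
  - exists []; simpl; repeat split; auto. now rewrite ginv1.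
  - exists (w' ++ [a^-1]). repeat split.
    + apply Forall_app; split; auto using letter_inv.
    + rewrite length_app; simpl; lia.
    + rewrite wprod_app, E; simpl; grp.
Qed.

Lemma word_mem Sg K w : is_subgroup K -> Forall K Sg -> Forall (letter Sg) w -> K (wprod w).
Proof.
  intros HK HS. induction 1 as [|a w Ha Hw IH]; simpl; mem.
  rewrite Forall_forall in HS. destruct Ha as [Ha|[s [Hs ->]]]; mem.
Qed.

Lemma ball_list Sg n :
  exists l, forall w, Forall (letter Sg) w -> length w <= n -> In (wprod w) l.
Proof.
  induction n as [|n [l Hl]].
  - exists [gone]; intros [|a w] _ L; simpl in *; [auto|lia].
  - exists (gone :: flat_map (fun a => map (gmul a) l) (Sg ++ map ginv Sg)).
    intros [|a w] F L; simpl; [auto|right].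
    inversion F; subst. apply in_flat_map. exists a; split; [now apply letter_in|].
    apply in_map, Hl; auto. simpl in L; lia.
Qed.

Lemma word_length_bound Sg (l : list G) : generates Sg ->
  exists n, forall x, In x l ->
    exists w, Forall (letter Sg) w /\ length w <= n /\ x = wprod w.
Proof.
  intros HS. induction l as [|a l [n Hn]].
  - exists 0; intros _ [].
  - destruct (HS a) as [w [F E]]. exists (length w + n). intros x [->|Hx].
    + exists w; repeat split; auto; lia.
    + destruct (Hn x Hx) as [w' [F' [L' E']]]. exists w'; repeat split; auto; lia.
Qed.

Lemma Zbound {A : Type} (f : A -> Z) (l : list A) :
  exists D, (0 <= D)%Z /\ forall a, In a l -> (Z.abs (f a) <= D)%Z.
Proof.
  induction l as [|a l [D [D0 HD]]].
  - exists 0%Z; split; [lia|intros _ []].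
  - exists (D + Z.abs (f a))%Z. split; [lia|]. intros b [<-|Hb]; [lia|].
    specialize (HD b Hb); lia.
Qed.

(** * Classical filtering and pigeonhole principles *)

Lemma exact_list {A : Type} (P : A -> Prop) (l : list A) :
  exists l', forall a, In a l' <-> In a l /\ P a.
Proof.
  exists (filter (fun a => if excluded_middle_informative (P a) then true else false) l).
  intros a. rewrite filter_In. destruct excluded_middle_informative; intuition discriminate.
Qed.

Lemma exact_nodup {A : Type} (P : A -> Prop) (l : list A) :
  (forall a, P a -> In a l) -> exists l', NoDup l' /\ forall a, In a l' <-> P a.
Proof.
  intros Hl. destruct (exact_list P l) as [l' Hl'].
  exists (nodup (fun a b => excluded_middle_informative (a = b)) l'). split.
  - apply NoDup_nodup.
  - intros a. rewrite nodup_In, Hl'. firstorder.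
Qed.

(** Induction on the list: each [a] splits the current infinite set of indices according to [Q _ a],
    and an infinite part on which [Q _ a] is constant is kept. *)
Lemma agreeing_indices {A : Type} (Q : nat -> A -> Prop) (l : list A) :
  exists k k', k < k' /\ forall a, In a l -> (Q k a <-> Q k' a).
Proof.
  assert (Inf : exists I : nat -> Prop, (forall n, exists m, n <= m /\ I m) /\
    forall k k', I k -> I k' -> forall a, In a l -> (Q k a <-> Q k' a)).
  { induction l as [|a l [I [HI HQ]]].
    - exists (fun _ => True). split; [intros n; exists n; auto|intros ? ? _ _ _ []].
    - destruct (classic (forall n, exists m, n <= m /\ I m /\ Q m a)) as [Y|N].
      + exists (fun m => I m /\ Q m a). split; [exact Y|].
        intros k k' [Ik Qk] [Ik' Qk'] b [<-|Hb]; [tauto|auto].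
      + apply not_all_ex_not in N as [n Hn].
        exists (fun m => I m /\ n <= m). split.
        * intros n'. destruct (HI (n + n')) as [m [L Im]]. exists m. repeat split; auto; lia.
        * intros k k' [Ik Lk] [Ik' Lk'] b [<-|Hb]; [|auto].
          split; intros Hq; exfalso; apply Hn; eauto. }
  destruct Inf as [I [HI HQ]]. destruct (HI 0) as [k [_ Ik]].
  destruct (HI (k + 1)) as [k' [L Ik']]. exists k, k'. split; [lia|auto].
Qed.

Lemma infinite_pigeonhole {A : Type} (Q : nat -> A -> Prop) (l : list A) :
  (forall k, exists a, In a l /\ Q k a) ->
  exists k k' a, k < k' /\ Q k a /\ Q k' a.
Proof.
  intros HQ. destruct (agreeing_indices Q l) as [k [k' [L E]]].
  destruct (HQ k) as [a [Ha Qa]]. exists k, k', a. repeat split; auto. now apply E.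
Qed.

Lemma finite_pigeonhole {A : Type} (Q : nat -> A -> Prop) (l : list A) :
  (forall k, k <= length l -> exists a, In a l /\ Q k a) ->
  exists k k' a, k < k' <= length l /\ Q k a /\ Q k' a.
Proof.
  revert Q. induction l as [|b l IH]; intros Q HQ.
  - destruct (HQ 0 (le_n _)) as [a [[] _]].
  - destruct (classic (exists k k', k < k' <= length (b :: l) /\ Q k b /\ Q k' b))
      as [[k [k' ?]]|N]; [now exists k, k', b|].
    destruct (classic (exists k, k <= length (b :: l) /\ Q k b)) as [[j [Lj Qj]]|N2].
    (* The index [j] that hits [b] is skipped: the reindexing enumerates the indices other than
       [j]. *)
    + destruct (IH (fun k a => Q (if k <? j then k else k + 1) a)) as [k [k' [a [L [Qk Qk']]]]].
      * intros k Lk. simpl in *.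
        destruct (HQ (if k <? j then k else k + 1)) as [a [[<-|Ha] Qa]]; eauto.
        { destruct (k <? j); lia. }
        exfalso; apply N. destruct (Nat.ltb_spec k j); [exists k, j|exists j, (k + 1)];
          repeat split; auto; lia.
      * exists (if k <? j then k else k + 1), (if k' <? j then k' else k' + 1), a.
        simpl. destruct (Nat.ltb_spec k j), (Nat.ltb_spec k' j); repeat split; auto; lia.
    + destruct (IH Q) as [k [k' [a [L ?]]]].
      * intros k Lk. destruct (HQ k) as [a [[<-|Ha] Qa]]; eauto; [simpl; lia|].
        exfalso; apply N2. exists k; simpl; split; auto; lia.
      * exists k, k', a. simpl; intuition lia.
Qed.

(** If no independent list were maximal, independent lists could be grown one element at a time to
    length [1 + L], against the hypothesis. Both orders of [E] occur because symmetry is not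
    assumed. *)
Lemma maximal_independent (P : G -> Prop) (E : G -> G -> Prop) (L : nat) :
  (forall x, E x x) ->
  (forall g : nat -> G, (forall i, i <= L -> P (g i)) ->
     exists i j, i < j <= L /\ (E (g i) (g j) \/ E (g j) (g i))) ->
  exists l, Forall P l /\ ForallOrdPairs (fun x y => ~ E x y /\ ~ E y x) l /\
    forall x, P x -> exists y, In y l /\ (E x y \/ E y x).
Proof.
  intros Erefl HL. apply NNPP; intros N.
  assert (Grow : forall n, exists l, length l = n /\ Forall P l /\
    ForallOrdPairs (fun x y => ~ E x y /\ ~ E y x) l).
  { induction n as [|n [l [Ln [Pl Dl]]]].
    - exists []; repeat split; constructor.
    - apply NNPP; intros N'. apply N. exists l; repeat split; auto.
      intros x Px. apply NNPP; intros Nx. apply N'.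
      exists (x :: l). repeat split; simpl; auto. constructor; auto.
      apply Forall_forall. intros y Hy; split; intros e; apply Nx; eauto. }
  destruct (Grow (1 + L)) as [l [Ln [Pl Dl]]].
  destruct (HL (fun i => nth i l gone)) as [i [j [Lij e]]].
  { intros i Li. rewrite Forall_forall in Pl. apply Pl, nth_In. lia. }
  assert (Pw : forall (l : list G), ForallOrdPairs (fun x y => ~ E x y /\ ~ E y x) l ->
    forall i j, i < j < length l -> ~ E (nth i l gone) (nth j l gone) /\ ~ E (nth j l gone) (nth i l gone)).
  { clear. induction 1 as [|a l Ha Hl IH]; intros i j Lij; simpl in *; [lia|].
    destruct j as [|j]; [lia|]. destruct i as [|i].
    - rewrite Forall_forall in Ha. apply Ha, nth_In; lia.
    - apply IH; lia. }
  destruct (Pw l Dl i j); [lia|]. tauto.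
Qed.

Lemma infinite_family (P : G -> Prop) (E : G -> G -> Prop) (L : nat) :
  (forall x, E x x) -> (forall x y, E x y -> E y x) ->
  ~ (exists l, forall x, P x -> exists y, In y l /\ E x y) ->
  exists g : nat -> G, (forall i, i <= L -> P (g i)) /\
    forall i j, i <= L -> j <= L -> i <> j -> ~ E (g i) (g j).
Proof.
  intros Er Es N. apply NNPP; intros N'. apply N.
  destruct (maximal_independent P E L) as [l [_ [_ Hl]]]; auto.
  - intros g Pg. apply NNPP; intros N2. apply N'. exists g; split; auto.
    intros i j Li Lj D e. apply N2.
    destruct (Nat.lt_ge_cases i j); [exists i, j|exists j, i]; split; auto; lia.
  - exists l. intros x Px. destruct (Hl x Px) as [y [Hy [e|e]]]; eauto.
Qed.

(** * Finite sets of cosets and subgroups of finite index *)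

Lemma finite_vset_sub K Z Z' :
  (forall x, Z x -> Z' x) -> finite_vset K Z' -> finite_vset K Z.
Proof. intros HZ [l Hl]. exists l; auto. Qed.

Lemma finite_vset_union K Z Z' :
  finite_vset K Z -> finite_vset K Z' -> finite_vset K (fun x => Z x \/ Z' x).
Proof.
  intros [l Hl] [l' Hl']. exists (l ++ l'). intros z [Hz|Hz];
    [destruct (Hl z Hz) as [x []]|destruct (Hl' z Hz) as [x []]]; exists x;
    rewrite in_app_iff; auto.
Qed.

Lemma finite_vset_union_list K {A : Type} (Z : A -> G -> Prop) (l : list A) :
  (forall a, In a l -> finite_vset K (Z a)) ->
  finite_vset K (fun x => exists a, In a l /\ Z a x).
Proof.
  intros Hl. induction l as [|a l IH].
  - exists []. intros z [a [[] _]].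
  - apply finite_vset_sub with (Z' := fun x => Z a x \/ exists a, In a l /\ Z a x).
    + intros x [b [[->|Hb] Hx]]; eauto.
    + apply finite_vset_union; [apply Hl; now left|apply IH; intros; apply Hl; now right].
Qed.

Lemma finite_vset_trans K K' Z :
  finite_vset K Z -> finite_vset K' K -> finite_vset K' Z.
Proof.
  intros [l Hl] [l' Hl'].
  exists (flat_map (fun x => map (fun y => y ** x) l') l).
  intros z Hz. destruct (Hl z Hz) as [x [Hx Kx]]. destruct (Hl' _ Kx) as [y [Hy Ky]].
  exists (y ** x). split.
  - apply in_flat_map. exists x; split; auto. apply in_map_iff; eauto.
  - unfold same_rcoset in *. now rewrite ginv_mul, gassoc.
Qed.

Lemma finite_vset_shift K Z y : finite_vset K Z -> finite_vset K (fun x => Z (x ** y)).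
Proof.
  intros [l Hl]. exists (map (fun x => x ** y^-1) l). intros z Hz.
  destruct (Hl _ Hz) as [x [Hx Kx]]. exists (x ** y^-1). split.
  - apply in_map_iff; eauto.
  - unfold same_rcoset in *. refine (eq_ind _ K Kx _ _). grp.
Qed.

Lemma bounded_finite_vset H Sg Z : is_subgroup H ->
  bounded_vset H Sg Z -> finite_vset H Z.
Proof.
  intros HH [x [n Hn]]. destruct (ball_list Sg n) as [l Hl].
  exists (map (gmul x) l). intros z Hz.
  destruct (Hn z Hz) as [w [h [F [L [Hh E]]]]].
  exists (x ** wprod w). split; [apply in_map; auto|].
  unfold same_rcoset. rewrite E. mem_as (h^-1).
Qed.

(** Inversion exchanges the right cosets counted by [finite_vset] with the left cosets counted by
    [finite_index_in]. *)
Lemma finite_index_in_of_vset K Z : is_subgroup K -> (forall x, Z x -> Z (x^-1)) ->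
  finite_vset K Z -> finite_index_in Z K.
Proof.
  intros HK HZ [l Hl]. exists (map ginv l). intros a Ha.
  destruct (Hl _ (HZ a Ha)) as [x [Hx Kx]]. exists (x^-1). split; [now apply in_map|].
  unfold same_rcoset in Kx. mem_as ((a^-1 ** x^-1)^-1).
Qed.

Lemma finite_vset_of_index_in K Z : is_subgroup K -> (forall x, Z x -> Z (x^-1)) ->
  finite_index_in Z K -> finite_vset K Z.
Proof.
  intros HK HZ [l Hl]. exists (map ginv l). intros a Ha.
  destruct (Hl _ (HZ a Ha)) as [x [Hx Kx]]. exists (x^-1). split; [now apply in_map|].
  unfold same_rcoset. mem_as ((x^-1 ** a^-1)^-1).
Qed.

Lemma finite_index_in_sub A K K' :
  (forall x, K x -> K' x) -> finite_index_in A K -> finite_index_in A K'.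
Proof. intros HK [l Hl]. exists l. intros a Ha. destruct (Hl a Ha) as [x []]; eauto. Qed.

Definition inter (K K' : G -> Prop) : G -> Prop := fun x => K x /\ K' x.

Lemma inter_subgroup K K' : is_subgroup K -> is_subgroup K' -> is_subgroup (inter K K').
Proof.
  intros HK HK'. unfold inter. repeat split; try mem; intros.
  all: repeat match goal with H : _ /\ _ |- _ => destruct H end; mem.
Qed.

Lemma inter_finite_index A K K' : is_subgroup K -> is_subgroup K' ->
  finite_index_in A K -> finite_index_in A K' -> finite_index_in A (inter K K').
Proof.
  intros HK HK' [l Hl] [l' Hl'].
  set (P := fun xy z => K ((fst xy)^-1 ** z) /\ K' ((snd xy)^-1 ** z)).
  (* For each pair of left cosets [x K] and [y K'] a common element is chosen; when they are
     disjoint the value of [epsilon] is arbitrary and harmless. *)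
  exists (map (fun xy => epsilon (inhabits gone) (P xy)) (list_prod l l')).
  intros a Ha. destruct (Hl a Ha) as [x [Hx Kx]]. destruct (Hl' a Ha) as [y [Hy Ky]].
  exists (epsilon (inhabits gone) (P (x, y))). split.
  - apply in_map_iff. exists (x, y); split; auto. now apply in_prod.
  - assert (E : P (x, y) (epsilon (inhabits gone) (P (x, y)))).
    { apply epsilon_spec. exists a; split; assumption. }
    destruct E as [E1 E2]; simpl in *. set (z := epsilon _ _) in *. split.
    + mem_as ((x^-1 ** z)^-1 ** (x^-1 ** a)).
    + mem_as ((y^-1 ** z)^-1 ** (y^-1 ** a)).
Qed.

Definition gconj (y : G) (K : G -> Prop) : G -> Prop := fun x => K (y^-1 ** x ** y).

Lemma gconj_subgroup y K : is_subgroup K -> is_subgroup (gconj y K).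
Proof.
  intros HK. unfold gconj. repeat split.
  - mem_as gone.
  - intros a b Ha Hb. mem_as ((y^-1 ** a ** y) ** (y^-1 ** b ** y)).
  - intros a Ha. mem_as ((y^-1 ** a ** y)^-1).
Qed.

Lemma gconj_finite_index y K :
  finite_index_in (fun _ => True) K -> finite_index_in (fun _ => True) (gconj y K).
Proof.
  intros [l Hl]. exists (map (fun x => y ** x ** y^-1) l). intros a _.
  destruct (Hl (y^-1 ** a ** y) I) as [x [Hx Kx]]. exists (y ** x ** y^-1). split.
  - apply in_map_iff; eauto.
  - unfold gconj. refine (eq_ind _ K Kx _ _). grp.
Qed.

Lemma common_finite_index {A : Type} (l : list A) (Kf : A -> G -> Prop) :
  (forall a, In a l -> is_subgroup (Kf a) /\ finite_index_in (fun _ => True) (Kf a)) ->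
  is_subgroup (fun x => forall a, In a l -> Kf a x) /\
  finite_index_in (fun _ => True) (fun x => forall a, In a l -> Kf a x).
Proof.
  induction l as [|a l IH]; intros Hl.
  - split; [repeat split; simpl; tauto|exists [gone]; intros x _; exists gone; simpl; tauto].
  - destruct IH as [IH1 IH2]; [intros; apply Hl; now right|].
    destruct (Hl a) as [Ha1 Ha2]; [now left|].
    assert (E : (fun x => forall b, In b (a :: l) -> Kf b x) =
      inter (Kf a) (fun x => forall b, In b l -> Kf b x)).
    { apply functional_extensionality; intros x. apply propositional_extensionality.
      unfold inter; simpl. split; [auto|]. intros [? ?] b [<-|]; auto. }
    rewrite E. split; [now apply inter_subgroup|now apply inter_finite_index].
Qed.

End Finiteness.

(** * From virtual fibers to separability, bounded packing and double cosets *)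

Section EasyImplications.
Context {G : Group} {H : G -> Prop} (HH : is_subgroup H).

Lemma separable_of_virtual_fiber : virtual_fiber H -> separable H.
Proof.
  intros [_ [G' [H' [HG' [FG' [HH' [H'H [FH' [H'G' [_ [phi [phiM [phiS phiK]]]]]]]]]]]]] g Hg.
  destruct FH' as [l Hl].
  (* The modulus [M] will exceed every [|phi (y^-1 g)|], with [y] running over representatives of
     [H/H']. Outside [G'] the values of [phi] are arbitrary, but only finitely many occur. *)
  destruct (Zbound (fun y => phi (y^-1 ** g)) l) as [D [D0 HD]].
  set (M := (D + 1)%Z).
  set (GM := fun x => G' x /\ (M | phi x)%Z).
  assert (phi1 : phi gone = 0%Z) by (apply phiK; mem).
  assert (phiV : forall x, G' x -> phi (x^-1) = (- phi x)%Z).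
  { intros x Hx. assert (E := phiM x (x^-1) Hx ltac:(mem)). rewrite ginv_r in E. lia. }
  assert (HGM : is_subgroup GM).
  { unfold GM. split; [|split].
    - split; [mem|]. rewrite phi1. apply Z.divide_0_r.
    - intros x y [? ?] [? ?]. split; [mem|]. rewrite phiM by auto. now apply Z.divide_add_r.
    - intros x [? ?]. split; [mem|]. rewrite phiV by auto. now apply Z.divide_opp_r. }
  assert (FGM : finite_index_in (fun _ => True) GM).
  { apply finite_index_in_of_vset; auto. apply finite_vset_trans with G'.
    - now apply finite_vset_of_index_in.
    - set (r := fun i : nat => epsilon (inhabits gone) (fun x => G' x /\ phi x = Z.of_nat i)).
      assert (Hr : forall i, G' (r i) /\ phi (r i) = Z.of_nat i).
      { intros i. unfold r. apply epsilon_spec. apply phiS. }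
      exists (map r (seq 0 (Z.to_nat M))). intros x Hx.
      set (i := Z.to_nat (phi x mod M)).
      assert (Bi := Z.mod_pos_bound (phi x) M ltac:(lia)).
      destruct (Hr i) as [Gi Ei]. exists (r i). split.
      + apply in_map, in_seq. lia.
      + split; [mem|]. rewrite phiM, phiV, Ei by mem.
        exists (phi x / M)%Z. unfold i. rewrite Z2Nat.id by lia.
        assert (Ed := Z.div_mod (phi x) M ltac:(lia)). lia. }
  assert (H'GM : forall x, H' x -> GM x).
  { intros x Hx. split; auto. rewrite (proj2 (phiK x (H'G' x Hx)) Hx). apply Z.divide_0_r. }
  (* [N] is the intersection of the [H]-conjugates of [GM]; it is normalised by [H], so [H N] is a
     subgroup. *)
  set (N := fun x => forall h, H h -> GM (h^-1 ** x ** h)).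
  assert (HN : is_subgroup N).
  { unfold N. split; [|split].
    - intros h Hh. mem_as gone.
    - intros x y Hx Hy h Hh. mem_as ((h^-1 ** x ** h) ** (h^-1 ** y ** h)).
    - intros x Hx h Hh. mem_as ((h^-1 ** x ** h)^-1). }
  (* Since [H'] lies in [GM], the conjugate of [GM] by [h] depends only on the coset [h H'], so
     finitely many conjugates suffice. *)
  assert (FN : finite_index_in (fun _ => True) N).
  { destruct (exact_list H l) as [l' Hl'].
    destruct (common_finite_index l' (fun y => gconj y GM)) as [_ F].
    { intros a _. split; [now apply gconj_subgroup|now apply gconj_finite_index]. }
    refine (finite_index_in_sub _ _ _ _ F). intros x Hx h Hh.
    destruct (Hl h Hh) as [y [Hy Ky]].
    assert (Hly : In y l').
    { apply Hl'. split; auto. assert (H (y^-1 ** h)) by auto. mem_as (h ** (y^-1 ** h)^-1). }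
    assert (Kx := Hx y Hly). apply H'GM in Ky. unfold gconj in Kx.
    mem_as ((y^-1 ** h)^-1 ** (y^-1 ** x ** y) ** (y^-1 ** h)). }
  assert (Nconj : forall n h, N n -> H h -> N (h^-1 ** n ** h)).
  { intros n h Hn Hh k Hk. assert (E := Hn (h ** k) ltac:(mem)).
    refine (eq_ind _ GM E _ _). grp. }
  exists (fun x => exists h n, H h /\ N n /\ x = h ** n). split; [split; [|split]|split; [|split]].
  - exists gone, gone. split; [mem|split; [mem|grp]].
  - intros x y [h [n [Hh [Hn ->]]]] [k [m [Hk [Hm ->]]]].
    exists (h ** k), ((k^-1 ** n ** k) ** m). split; [mem|split; [mem|grp]].
  - intros x [h [n [Hh [Hn ->]]]]. exists (h^-1), (h ** n^-1 ** h^-1).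
    split; [mem|split; [|grp]].
    rewrite <- (ginvK h) at 1. apply Nconj; mem.
  - refine (finite_index_in_sub _ _ _ _ FN). intros n Hn. exists gone, n.
    split; [mem|split; [auto|grp]].
  - intros h Hh. exists h, gone. split; [auto|split; [mem|grp]].
  (* If [g = h n] with [h] in [y H'], then [phi n = phi (y^-1 g)] is a multiple of [M] of absolute
     value below [M], hence zero. So [n] lies in [H'], and [g] in [H]. *)
  - intros [h [n [Hh [Hn ->]]]]. destruct (Hl h Hh) as [y [Hy Ky]].
    destruct (Hn gone ltac:(mem)) as [Gn Dn]. rewrite ginv1, gone_l, gone_r in Gn, Dn.
    assert (Bd := HD y Hy). cbv beta in Bd.
    rewrite gassoc, phiM, (proj2 (phiK _ (H'G' _ Ky)) Ky) in Bd by auto.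
    assert (E : phi n = 0%Z).
    { destruct Dn as [q Eq]. rewrite Eq in *; destruct (Z.eq_dec q 0) as [->|nz]; [lia|].
      exfalso. rewrite Z.add_0_l, Z.abs_mul in Bd. nia. }
    apply Hg. apply phiK in E; auto. mem.
Qed.

Lemma bounded_packing_of_separable Sg : separable H -> bounded_packing H Sg.
Proof.
  intros Hsep D. destruct (ball_list Sg D) as [l Hl].
  (* For [b] in [H] the whole group qualifies, so a subgroup can be chosen for every point of the
     ball. *)
  set (P := fun b (K : G -> Prop) => is_subgroup K /\ finite_index_in (fun _ => True) K /\
    (forall h, H h -> K h) /\ (~ H b -> ~ K b)).
  set (Kf := fun b => epsilon (inhabits H) (P b)).
  assert (HKf : forall b, P b (Kf b)).
  { intros b. apply epsilon_spec. destruct (classic (H b)) as [Hb|Hb].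
    - exists (fun _ => True). repeat split; auto.
      exists [gone]; intros x _; exists gone; simpl; auto.
    - destruct (Hsep b Hb) as [K [? [? []]]]. exists K. split; [|split; [|split]]; auto. }
  destruct (common_finite_index l Kf) as [HK [lc Hlc]].
  { intros b _. destruct (HKf b) as [? []]; auto. }
  set (K := fun x => forall a, In a l -> Kf a x) in *.
  (* Two of the elements share a left coset of [K]. If their [H]-cosets were within [D], the
     connecting word would represent an element of [K] in the ball, and such an element lies in
     [H]. *)
  exists (length lc). intros g Hg. apply NNPP; intros N.
  destruct (finite_pigeonhole (fun i x => K (x^-1 ** g i)) lc) as [i [j [x [L [Ki Kj]]]]].
  { intros k _. now apply Hlc. }
  apply N. exists i, j. repeat split; try lia. intros [h [h' [Hh [Hh' [w [F [Lw E]]]]]]].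
  apply (Hg i j); try lia. unfold same_lcoset.
  assert (Ew : wprod w = h^-1 ** ((g i)^-1 ** g j) ** h').
  { apply (f_equal (gmul ((g i ** h)^-1))) in E. revert E. grp. intros ->. grp. }
  assert (KH : forall h, H h -> K h).
  { intros k Hk a _. destruct (HKf a) as [_ [_ [? _]]]; auto. }
  assert (Kw : K (wprod w)).
  { rewrite Ew. apply KH in Hh, Hh'. mem_as (h^-1 ** ((x^-1 ** g i)^-1 ** (x^-1 ** g j)) ** h'). }
  assert (Hw : H (wprod w)).
  { apply NNPP; intros Nw. destruct (HKf (wprod w)) as [_ [_ [_ X]]]. apply X; auto. }
  rewrite Ew in Hw. mem_as (h ** (h^-1 ** ((g i)^-1 ** g j) ** h') ** h'^-1).
Qed.

(** Infinite index provides arbitrarily many distinct left cosets. Finitely many double coset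
    representatives have length at most some [D], and [g_i^-1 g_j = h x h'] puts a point of [g_i H]
    within [|x|] of [g_j H]. *)
Lemma infinitely_many_dcosets_of_bounded_packing Sg : generates Sg ->
  ~ finite_vset H (fun _ => True) -> bounded_packing H Sg -> infinitely_many_dcosets H.
Proof.
  intros HS Hinf HBP [l Hl].
  destruct (word_length_bound Sg l HS) as [D HD].
  destruct (HBP D) as [R HR].
  destruct (infinite_family (fun _ => True) (same_lcoset H) R) as [g [_ Hg]].
  - intros x. unfold same_lcoset. mem_as gone.
  - intros x y E. unfold same_lcoset in *. mem_as ((x^-1 ** y)^-1).
  - intros [m Hm]. apply Hinf, finite_vset_of_index_in; auto. exists m. intros a _.
    destruct (Hm a I) as [y [Hy E]]. exists y; split; auto.
    unfold same_lcoset in E. mem_as ((a^-1 ** y)^-1).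
  - destruct (HR g) as [i [j [Li [Lj [Dij N]]]]]; auto. apply N.
    destruct (Hl ((g i)^-1 ** g j)) as [x [Hx [h [h' [Hh [Hh' E]]]]]].
    destruct (HD x Hx) as [w [F [Lw ->]]].
    exists h, (h'^-1). repeat split; try mem. exists w. repeat split; auto.
    rewrite <- (gmulKV (g i) (g j)), E. grp.
Qed.

End EasyImplications.

(** * Integer powers and cyclic subgroups *)

Section Powers.
Context {G : Group}.

Definition npow (t : G) (n : nat) : G := Nat.iter n (gmul t) gone.

Definition zpow (t : G) (k : Z) : G :=
  match k with
  | Z0 => gone
  | Zpos p => npow t (Pos.to_nat p)
  | Zneg p => (npow t (Pos.to_nat p))^-1
  end.

Lemma zpow_of_nat t n : zpow t (Z.of_nat n) = npow t n.
Proof. destruct n; simpl; [reflexivity|]. now rewrite SuccNat2Pos.id_succ. Qed.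

Lemma zpow_opp_nat t n : zpow t (- Z.of_nat n) = (npow t n)^-1.
Proof. destruct n; simpl; [now rewrite ginv1|]. now rewrite SuccNat2Pos.id_succ. Qed.

Lemma npow_comm (t : G) n : npow t n ** t = t ** npow t n.
Proof. induction n as [|n IH]; simpl; grp. now rewrite IH. Qed.

Lemma zpow_succ t k : zpow t (k + 1) = t ** zpow t k.
Proof.
  destruct (Z_lt_le_dec k 0) as [Hk|Hk].
  - replace k with (- Z.of_nat (1 + Z.to_nat (- k - 1)))%Z by lia.
    set (n := Z.to_nat _).
    replace (- Z.of_nat (1 + n) + 1)%Z with (- Z.of_nat n)%Z by lia.
    rewrite !zpow_opp_nat. simpl. rewrite <- npow_comm. grp.
  - replace k with (Z.of_nat (Z.to_nat k)) by lia. set (n := Z.to_nat k).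
    replace (Z.of_nat n + 1)%Z with (Z.of_nat (1 + n)) by lia.
    now rewrite !zpow_of_nat.
Qed.

Lemma zpow_add t a b : zpow t (a + b) = zpow t a ** zpow t b.
Proof.
  revert b. induction a as [|a IH|a IH] using Z.peano_ind; intros b.
  - simpl; grp.
  - replace (Z.succ a + b)%Z with ((a + b) + 1)%Z by lia.
    unfold Z.succ. rewrite !zpow_succ, IH; grp.
  - assert (E : forall c, zpow t c = t^-1 ** zpow t (c + 1)).
    { intros c. rewrite zpow_succ. grp. }
    rewrite (E (Z.pred a + b)%Z), (E (Z.pred a)).
    replace (Z.pred a + b + 1)%Z with (a + b)%Z by lia.
    replace (Z.pred a + 1)%Z with a by lia. rewrite IH. grp.
Qed.

Lemma zpow_1 t : zpow t 1 = t.
Proof. simpl. apply gone_r. Qed.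

Lemma zpow_opp t k : zpow t (- k) = (zpow t k)^-1.
Proof.
  apply ginv_unique. rewrite <- zpow_add. now replace (k + - k)%Z with 0%Z by lia.
Qed.

Lemma zpow_sub t a b : zpow t (a - b) = zpow t a ** (zpow t b)^-1.
Proof. unfold Z.sub. now rewrite zpow_add, zpow_opp. Qed.

Lemma zpow_mem (K : G -> Prop) t k : is_subgroup K -> K t -> K (zpow t k).
Proof.
  intros HK Ht. assert (X : forall n, K (npow t n)) by (induction n; simpl; mem).
  destruct k; simpl; mem.
Qed.

Definition zpowers (t : G) : G -> Prop := fun x => exists k, x = zpow t k.

Lemma zpowers_subgroup t : is_subgroup (zpowers t).
Proof.
  split; [|split].
  - now exists 0%Z.
  - intros x y [a ->] [b ->]. exists (a + b)%Z. symmetry; apply zpow_add.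
  - intros x [a ->]. exists (- a)%Z. now rewrite zpow_opp.
Qed.

Lemma zpowers_fin_gen t : fin_gen_subgroup (zpowers t).
Proof.
  exists [t]. split.
  - constructor; auto. exists 1%Z. now rewrite zpow_1.
  - intros x; split.
    + intros [k ->].
      assert (X : forall n, exists w, Forall (letter [t]) w /\ npow t n = wprod w).
      { induction n as [|n [w [F E]]]; [exists []; split; auto|].
        exists (t :: w). simpl; rewrite E. split; auto. constructor; auto. left; now left. }
      destruct k as [|p|p]; simpl.
      * exists []; auto.
      * apply X.
      * destruct (X (Pos.to_nat p)) as [w [F ->]].
        destruct (word_inv [t] w F) as [w' [F' [_ <-]]]; eauto.
    + intros [w [F ->]]. apply (word_mem [t]); auto using zpowers_subgroup.
      constructor; auto. exists 1%Z. now rewrite zpow_1.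
Qed.

End Powers.

(** * Consequences of narrowness *)

Section Narrow.
Context {G : Group} {Sg : list G} {H : G -> Prop}.
Context (HS : generates Sg) (HH : is_subgroup H) (Hnar : narrow H Sg).

(** The union of the cosets in the orbit of [H g] under right translation by [Q]. *)
Definition dcoset (Q : G -> Prop) (g : G) : G -> Prop :=
  fun z => exists h q, H h /\ Q q /\ z = h ** g ** q.

Lemma cdist_word n x w : Forall (letter Sg) w -> length w <= n ->
  cdist_le H Sg x (x ** wprod w) n.
Proof. intros F L. exists w, gone. repeat split; auto; [mem|grp]. Qed.

Lemma cdist_coset n x h : H h -> cdist_le H Sg x (h ** x) n.
Proof.
  intros Hh. exists [], (h^-1). repeat split; auto; [simpl; lia|mem|simpl; grp].
Qed.

Lemma chain_trans Z mu x y z : coarse_chain H Sg Z mu x y ->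
  coarse_chain H Sg Z mu y z -> coarse_chain H Sg Z mu x z.
Proof. induction 1; intros; auto. eapply cc_step; eauto. Qed.

(** Right multiplication by a generator of [Q] moves a vertex by at most the word length of that
    generator, a bound independent of [g]. *)
Lemma dcoset_coarsely_connected Q : is_subgroup Q -> fin_gen_subgroup Q ->
  exists mu, 1 <= mu /\ forall g, coarsely_connected H Sg mu (dcoset Q g).
Proof.
  intros HQ [T [FT HT]].
  destruct (word_length_bound Sg (T ++ map ginv T) HS) as [n Hn].
  exists (1 + n). split; [lia|]. intros g z z' [h [q [Hh [Hq ->]]]] [h' [q' [Hh' [Hq' ->]]]].
  assert (Walk : forall w, Forall (letter T) w -> forall z, dcoset Q g z ->
    coarse_chain H Sg (dcoset Q g) (1 + n) z (z ** wprod w)).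
  { assert (QT : forall a, letter T a -> Q a).
    { intros a Ha. apply HT. exists [a]. split; auto. simpl; grp. }
    induction 1 as [|a w Ha Hw IH]; intros z Hz; simpl.
    - rewrite gone_r. now constructor.
    - destruct (Hn a) as [u [Fu [Lu Eu]]]; [now apply letter_in|].
      rewrite gassoc. apply cc_step with (z ** a); auto.
      + rewrite Eu. apply cdist_word; auto; lia.
      + apply IH. destruct Hz as [k [r [Hk [Hr ->]]]].
        exists k, (r ** a). assert (Q a) by auto. repeat split; [auto|mem|grp]. }
  destruct (proj1 (HT (q^-1 ** q')) ltac:(mem)) as [w [F E]].
  apply cc_step with ((h' ** h^-1) ** (h ** g ** q)).
  - exists h, q; auto.
  - apply cdist_coset; mem.
  - replace (h' ** g ** q') with (((h' ** h^-1) ** (h ** g ** q)) ** wprod w)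
      by (rewrite <- E; grp).
    apply Walk; auto. exists h', q. repeat split; auto. grp.
Qed.

(** Distinct double cosets are disjoint and coarsely connected at a common scale. Those infinite
    modulo [H] are unbounded, because balls are finite, so narrowness bounds their number. *)
Lemma narrow_dcosets Q (P : G -> Prop) : is_subgroup Q -> fin_gen_subgroup Q ->
  (forall g, P g -> ~ finite_vset H (dcoset Q g)) ->
  exists l, Forall P l /\ ForallOrdPairs (fun x y => ~ dcoset Q x y) l /\
    forall x, P x -> exists y, In y l /\ dcoset Q y x.
Proof.
  intros HQ FQ HP. destruct (dcoset_coarsely_connected Q HQ FQ) as [mu [Hmu Hc]].
  assert (Sym : forall x y, dcoset Q x y -> dcoset Q y x).
  { intros x y [h [q [Hh [Hq ->]]]]. exists (h^-1), (q^-1). repeat split; try mem. grp. }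
  destruct (Hnar mu Hmu) as [L [HL HY]].
  destruct (maximal_independent P (dcoset Q) L) as [l [Pl [Dl Cl]]].
  - intros x. exists gone, gone. repeat split; try mem. grp.
  - intros g Pg. destruct (HY (fun i => dcoset Q (g i))) as [i [j [Li [Lj [D [z [Hi Hj]]]]]]].
    + intros i Li. split; [|split]; auto.
      * intros k x Hk [h [q [Hh [Hq ->]]]]. exists (k ** h), q. repeat split; auto; [mem|grp].
      * intros B. apply (HP (g i)); auto. eapply bounded_finite_vset; eauto.
    + assert (E : dcoset Q (g i) (g j)).
      { destruct Hi as [h [q [Hh [Hq ->]]]], Hj as [h' [q' [Hh' [Hq' E]]]].
        exists (h'^-1 ** h), (q ** q'^-1). repeat split; try mem.
        apply (f_equal (fun x => h'^-1 ** x ** q'^-1)) in E. revert E; grp. intros E; now rewrite <- E. }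
      destruct (Nat.lt_ge_cases i j); [exists i, j|exists j, i]; split; auto; lia.
  - exists l. split; [|split]; auto.
    + clear - Dl. induction Dl as [|a l Ha Hl IH]; constructor; auto.
      revert Ha. apply Forall_impl. tauto.
    + intros x Px. destruct (Cl x Px) as [y [Hy [E|E]]]; eauto.
Qed.

(** Equivalently, the intersection of [H] with [g^-1 H g] has finite index in [H]; imposing this on
    both [g] and [g^-1] gives the commensurator. *)
Definition half_comm (g : G) : Prop := finite_vset H (fun z => exists h, H h /\ z = g ** h).

Definition comm (g : G) : Prop := half_comm g /\ half_comm (g^-1).

Lemma half_comm_mul f g : half_comm f -> half_comm g -> half_comm (f ** g).
Proof.
  intros [lf Hf] [lg Hg].
  exists (flat_map (fun x => map (fun y => y ** x) lf) lg).
  intros z [h [Hh ->]]. destruct (Hg (g ** h)) as [x [Hx Ex]]; eauto.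
  unfold same_rcoset in *.
  destruct (Hf (f ** (g ** h ** x^-1))) as [y [Hy Ey]]; eauto.
  exists (y ** x). split.
  - apply in_flat_map. exists x; split; auto. apply in_map_iff; eauto.
  - refine (eq_ind _ H Ey _ _). grp.
Qed.

Lemma comm_of_mem h : H h -> comm h.
Proof.
  intros Hh. split; exists [gone]; intros z [k [Hk ->]]; exists gone;
    (split; [now left|]); unfold same_rcoset; mem.
Qed.

Lemma comm_subgroup : is_subgroup comm.
Proof.
  split; [|split].
  - apply comm_of_mem; mem.
  - intros x y [] []. split; [|rewrite ginv_mul]; now apply half_comm_mul.
  - intros x []. split; [|rewrite ginvK]; auto.
Qed.

(** Outside [comm], one of [g], [g^-1] has a double coset infinite modulo [H], and narrowness leaves
    finitely many of these; inversion carries double cosets to double cosets. Were [comm] finite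
    modulo [H], there would be finitely many double cosets altogether. *)
Lemma comm_infinite : fin_gen_subgroup H -> infinitely_many_dcosets H ->
  ~ finite_vset H comm.
Proof.
  intros FH Hinf [lc Hlc].
  destruct (narrow_dcosets H (fun g => ~ half_comm g)) as [l [_ [_ Hl]]]; auto.
  { intros g Hg F. apply Hg. refine (finite_vset_sub _ _ _ _ F).
    intros z [h [Hh ->]]. exists gone, h. repeat split; auto; [mem|grp]. }
  apply Hinf. exists (lc ++ l ++ map ginv l). intros g.
  destruct (classic (comm g)) as [Hg|Hg].
  - destruct (Hlc g Hg) as [x [Hx E]]. exists x. rewrite in_app_iff. split; auto.
    exists (g ** x^-1), gone. repeat split; [auto|mem|grp].
  - apply not_and_or in Hg as [Hg|Hg]; destruct (Hl _ Hg) as [x [Hx [h [q [Hh [Hq E]]]]]].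
    + exists x. rewrite !in_app_iff. split; auto. exists h, q. repeat split; auto.
      rewrite E; grp.
    + exists (x^-1). rewrite !in_app_iff. split; [right; right; now apply in_map|].
      exists (q^-1), (h^-1). repeat split; try mem.
      rewrite <- (ginvK g), E. grp.
Qed.

(** * A connected transversal of [C\G] *)

Section Transversal.
Context {C : G -> Prop} (HC : is_subgroup C).

(** The distance from [C g] to [C] in the Schreier graph of [C] is at most [n]. *)
Definition level (g : G) (n : nat) : Prop :=
  exists w, Forall (letter Sg) w /\ length w <= n /\ C (g ** wprod w).

(** The letters leading strictly closer to [C]; some bound [n] witnesses the drop without a distance
    function. *)
Definition descent (g : G) : G -> Prop :=
  fun s => letter Sg s /\ exists n, level (g ** s) n /\ ~ level g n.

(* The descent direction depends only on the coset [C g], which makes [sect] a transversal. *)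
Definition parent_letter (g : G) : G := epsilon (inhabits gone) (descent g).

(** Parents define a spanning tree of the Schreier graph of [C]; [sect] is the vertex set of its
    lift through [gone] to the Cayley graph of [G]. *)
Inductive sect : G -> Prop :=
| sect_one : sect gone
| sect_step g : sect (g ** parent_letter g) -> ~ C g -> sect g.

Lemma level_coset g g' n : C (g ** g'^-1) -> level g n -> level g' n.
Proof.
  intros Hg [w [F [L E]]]. exists w; repeat split; auto.
  mem_as ((g ** g'^-1)^-1 ** (g ** wprod w)).
Qed.

Lemma parent_letter_coset g g' : C (g ** g'^-1) -> parent_letter g = parent_letter g'.
Proof.
  intros Hg.
  assert (X : forall a b s, C (a ** b^-1) -> descent a s -> descent b s).
  { intros a b s Hab [Ls [n [L N]]]. split; auto. exists n. split.
    - apply (level_coset (a ** s)); auto. refine (eq_ind _ C Hab _ _). grp.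
    - intros L'. apply N. apply (level_coset b); auto. mem_as ((a ** b^-1)^-1). }
  unfold parent_letter. f_equal. apply functional_extensionality; intros s.
  apply propositional_extensionality. split; apply X; auto. mem_as ((g ** g'^-1)^-1).
Qed.

Lemma descent_parent g : ~ C g -> descent g (parent_letter g).
Proof.
  intros Ng. unfold parent_letter. apply epsilon_spec.
  destruct (HS (g^-1)) as [w [F E]].
  assert (L : level g (length w)) by (exists w; repeat split; auto; rewrite <- E; mem_as gone).
  clear E F. set (n := length w) in L. clearbody n. clear w.
  induction n as [|n IH].
  - destruct L as [[|a w] [F [L E]]]; simpl in *; [|lia]. rewrite gone_r in E; tauto.
  - destruct (classic (level g n)) as [L'|N]; auto.
    destruct L as [[|a w] [F [L E]]]; simpl in *; [rewrite gone_r in E; tauto|].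
    inversion F; subst. exists a. split; auto. exists n. split; auto.
    exists w; repeat split; auto; [lia|]. now rewrite gassoc_r.
Qed.

(** Points of one coset of [C] have the same parent letter, so their descending paths use the same
    letters and both end at [gone]. *)
Lemma sect_unique z z' : sect z -> sect z' -> C (z ** z'^-1) -> z = z'.
Proof.
  intros Hz. revert z'. induction Hz as [|z Hz IH Nz]; intros z' Hz' E.
  - destruct Hz' as [|z' _ Nz']; auto. exfalso; apply Nz'. mem_as ((gone ** z'^-1)^-1).
  - destruct Hz' as [|z' Hz' Nz'].
    + exfalso; apply Nz. mem_as (z ** gone^-1).
    + assert (Ep := parent_letter_coset z z' E).
      assert (X : z ** parent_letter z = z' ** parent_letter z').
      { apply IH; auto. rewrite Ep. refine (eq_ind _ C E _ _). grp. }
      rewrite Ep in X. apply (f_equal (fun x => x ** (parent_letter z')^-1)) in X.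
      revert X; now grp.
Qed.

Lemma sect_cover g : exists z, sect z /\ C (g ** z^-1).
Proof.
  destruct (HS (g^-1)) as [w [F E]].
  assert (L : level g (length w)) by (exists w; repeat split; auto; rewrite <- E; mem_as gone).
  clear E F. set (n := length w) in L. clearbody n. clear w. revert g L.
  induction n as [|n IH]; intros g L.
  - exists gone. split; [constructor|].
    destruct L as [[|a w] [F [L E]]]; simpl in *; [|lia]. mem_as (g ** gone).
  - destruct (classic (C g)) as [Hg|Ng].
    { exists gone. split; [constructor|]. mem_as (g ** gone). }
    destruct (descent_parent g Ng) as [_ [m [Lm Nm]]].
    (* [level g] is monotone in its bound and fails at [m], so the induction hypothesis applies to
       the parent. *)
    assert (m <= n).
    { destruct (Nat.le_gt_cases m n); auto. exfalso; apply Nm.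
      destruct L as [w [F [L E]]]. exists w; repeat split; auto; lia. }
    destruct (IH (g ** parent_letter g)) as [z [Hz Ez]].
    { destruct Lm as [w [F [L' E]]]. exists w; repeat split; auto; lia. }
    set (s := parent_letter g) in *.
    assert (Ez' : C (g ** (z ** s^-1)^-1)) by (refine (eq_ind _ C Ez _ _); grp).
    exists (z ** s^-1). split; auto. constructor.
    + rewrite <- (parent_letter_coset g _ Ez'). fold s.
      refine (eq_ind _ sect Hz _ _). grp.
    + intros Cz. apply Ng. mem_as ((g ** (z ** s^-1)^-1) ** (z ** s^-1)).
Qed.

Definition sheet (c : G) : G -> Prop := fun y => exists h z, H h /\ sect z /\ y = h ** c ** z.

(** Descending the tree joins each point [h c z] to [h c] by steps of length at most one, and all
    the points [h c] represent the vertex [H c]. *)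
Lemma sheet_coarsely_connected c : coarsely_connected H Sg 1 (sheet c).
Proof.
  assert (In1 : forall h z, H h -> sect z -> sheet c (h ** c ** z)).
  { intros h z Hh Hz. exists h, z; auto. }
  assert (Dn : forall z, sect z -> forall h, H h ->
    coarse_chain H Sg (sheet c) 1 (h ** c ** z) (h ** c) /\
    coarse_chain H Sg (sheet c) 1 (h ** c) (h ** c ** z)).
  { induction 1 as [|z Hz IH Nz]; intros h Hh.
    - rewrite gone_r. assert (X := In1 h gone Hh sect_one). rewrite gone_r in X.
      split; constructor; auto.
    - destruct (descent_parent z Nz) as [Ls _]. destruct (IH h Hh) as [IH1 IH2].
      set (s := parent_letter z) in *. assert (Sz : sect z) by now constructor.
      assert (D1 : forall x a, letter Sg a -> cdist_le H Sg x (x ** a) 1).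
      { intros x a Ha. replace (x ** a) with (x ** wprod [a]) by (simpl; grp).
        apply cdist_word; auto. }
      split.
      + apply cc_step with (h ** c ** (z ** s)); auto. rewrite (gassoc G _ z s). auto.
      + apply chain_trans with (h ** c ** (z ** s)); auto.
        apply cc_step with (h ** c ** z); auto.
        * replace (h ** c ** z) with (h ** c ** (z ** s) ** s^-1) by grp.
          auto using letter_inv.
        * constructor; auto. }
  intros y y' [h [z [Hh [Hz ->]]]] [h' [z' [Hh' [Hz' ->]]]].
  apply chain_trans with (h ** c); [apply Dn; auto|].
  assert (X := In1 h gone Hh sect_one). rewrite gone_r in X.
  apply cc_step with (h' ** c); auto.
  - replace (h' ** c) with ((h' ** h^-1) ** (h ** c)) by grp. apply cdist_coset; mem.
  - apply Dn; auto.
Qed.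

(* Translates by [C] of a connected transversal of [C\G] are pairwise disjoint modulo [H],
   so narrowness forbids an infinite transversal once [C/H] is infinite. *)
Lemma finite_index_of_infinite : (forall h, H h -> C h) -> ~ finite_vset H C ->
  finite_vset C (fun _ => True).
Proof.
  intros HHC Hinf. apply NNPP; intros N.
  destruct (Hnar 1 (le_n _)) as [L [HL HY]].
  destruct (infinite_family C (same_rcoset H) L) as [c [Cc Dc]].
  - intros x. unfold same_rcoset. mem_as gone.
  - intros x y E. unfold same_rcoset in *. mem_as ((x ** y^-1)^-1).
  - intros [l Hl]. apply Hinf. now exists l.
  - destruct (HY (fun i => sheet (c i))) as [i [j [Li [Lj [D [g [Hi Hj]]]]]]].
    + intros i Li. split; [|split; [|apply sheet_coarsely_connected]].
      * intros k y Hk [h [z [Hh [Hz ->]]]]. exists (k ** h), z. repeat split; [mem|auto|grp].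
      (* A bounded sheet meets finitely many cosets of [H]; their representatives, multiplied by
         [(c i)^-1], represent all cosets of [C]. *)
      * intros B. apply bounded_finite_vset in B as [l Hl]; auto. apply N.
        exists (map (gmul (c i)^-1) l). intros g _.
        destruct (sect_cover g) as [z [Hz Ez]].
        destruct (Hl (c i ** z)) as [x [Hx Ex]].
        { exists gone, z. repeat split; auto; [mem|grp]. }
        exists ((c i)^-1 ** x). split; [now apply in_map|]. unfold same_rcoset in *.
        apply HHC in Ex. assert (Ci := Cc i Li).
        mem_as ((g ** z^-1) ** (c i)^-1 ** (c i ** z ** x^-1) ** c i).
    + destruct Hi as [h [z [Hh [Hz ->]]]], Hj as [h' [z' [Hh' [Hz' E]]]].
      assert (Ci := Cc i Li). assert (Cj := Cc j Lj).
      assert (Ez : z ** z'^-1 = (c i)^-1 ** h^-1 ** h' ** c j).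
      { apply (f_equal (fun x => (c i)^-1 ** h^-1 ** x ** z'^-1)) in E. revert E; now grp. }
      assert (z = z').
      { apply sect_unique; auto. rewrite Ez. apply HHC in Hh, Hh'. mem. }
      subst z'. apply (Dc i j); auto. unfold same_rcoset.
      apply (f_equal (fun x => h^-1 ** x ** z^-1 ** (c j)^-1)) in E. revert E. grp.
      intros ->. mem.
Qed.

End Transversal.
End Narrow.

(** * A translation in the commensurator *)

Section Ends.
Context {G : Group} {Sg : list G} {H : G -> Prop}.
Context (HS : generates Sg) (HH : is_subgroup H) (FH : fin_gen_subgroup H).

(** The [r]-neighbourhood of [H] in the Cayley graph of [G]; modulo [H] it is the ball around the
    vertex [H]. *)
Definition nbhd (r : nat) : G -> Prop :=
  fun g => exists h w, H h /\ Forall (letter Sg) w /\ length w <= r /\ g = h ** wprod w.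

Lemma nbhd_mem r h : H h -> nbhd r h.
Proof. intros Hh. exists h, []. repeat split; auto; [simpl; lia|simpl; grp]. Qed.

Lemma nbhd_finite r : finite_vset H (nbhd r).
Proof.
  destruct (ball_list Sg r) as [l Hl]. exists l. intros z [h [w [Hh [F [L ->]]]]].
  exists (wprod w). split; auto. unfold same_rcoset. mem_as h.
Qed.

(** Connectedness in the Cayley graph of [G], as an induction principle. Once [r] is at least the
    length of each generator of [H], paths realising these generators between elements of [H] stay
    inside, and any other point is reached from [H] along its word. *)
Lemma nbhd_connected : exists r0, forall r, r0 <= r -> forall X : G -> Prop,
  (forall x s, letter Sg s -> nbhd r (x ** s) -> X x -> X (x ** s)) ->
  X gone -> forall x, nbhd r x -> X x.
Proof.
  destruct FH as [T [FT HT]].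
  destruct (word_length_bound Sg (T ++ map ginv T) HS) as [r0 Hr0].
  exists r0. intros r Lr X HX X1.
  assert (Out : forall h, H h -> X h -> forall w, Forall (letter Sg) w -> length w <= r ->
    X (h ** wprod w)).
  { intros h Hh Xh w. induction w as [|s w IH] using rev_ind; intros F L.
    - simpl. now rewrite gone_r.
    - apply Forall_app in F as [Fw Fs]. inversion Fs; subst.
      rewrite length_app in L; simpl in L.
      rewrite wprod_app; simpl; rewrite gone_r, gassoc. apply HX; auto.
      + exists h, (w ++ [s]). repeat split; auto.
        * apply Forall_app; auto.
        * rewrite length_app; simpl; lia.
        * rewrite wprod_app; simpl; grp.
      + apply IH; auto; lia. }
  assert (XH : forall h, H h -> X h).
  { intros h Hh. destruct (proj1 (HT h) Hh) as [u [Fu ->]]. clear Hh.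
    induction u as [|a u IH] using rev_ind; [assumption|].
    apply Forall_app in Fu as [Fu Fa]. inversion Fa; subst.
    destruct (Hr0 a) as [w [F [L E]]]; [now apply letter_in|].
    rewrite wprod_app; simpl; rewrite gone_r, E. apply Out; auto; [|lia].
    apply HT; eauto. }
  intros x [h [w [Hh [F [L ->]]]]]. auto.
Qed.

(** A union of connected components of the complement of [P] in the Cayley graph of [G]. *)
Definition side (P X : G -> Prop) : Prop :=
  (forall x, X x -> ~ P x) /\
  forall x s, X x -> letter Sg s -> ~ P (x ** s) -> X (x ** s).

(** Off [Y], translation by [f] avoids [P], because [f^-1 P] lies in [Y]. Follow a path from [x] to
    [P]: as long as it is off [Y], its translate stays in one side; a step into [Y] from outside can
    only start in [P], and [f P] lies in [X]. *)
Lemma side_translate (P X Y : G -> Prop) f : P gone -> side P X -> side P Y ->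
  (forall p, P p -> X (f ** p)) -> (forall p, P p -> Y (f^-1 ** p)) ->
  forall x, ~ Y x -> X (f ** x).
Proof.
  intros P1 [XP HX] [YP HY] fX fY x Nx.
  assert (Off : forall x, ~ Y x -> ~ P (f ** x)).
  { intros y Ny Py. apply Ny. apply fY in Py. now rewrite gmulVK in Py. }
  assert (Back : forall a s : G, a = a ** s ** s^-1) by (intros; grp).
  destruct (HS (x^-1)) as [w [F E]].
  assert (Pw : P (x ** wprod w)) by (rewrite <- E, ginv_r; auto).
  clear E. revert x Nx Pw. induction F as [|s w Ls Fw IH]; simpl; intros x Nx Pw.
  - rewrite gone_r in Pw. auto.
  - destruct (classic (Y (x ** s))) as [Ys|Ns].
    + apply fX. apply NNPP; intros NP. apply Nx. rewrite (Back x s).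
      apply HY; auto using letter_inv. now rewrite <- Back.
    + rewrite (Back (f ** x) s). apply HX; auto using letter_inv.
      * rewrite gassoc_r. apply IH; auto. now rewrite gassoc_r.
      * rewrite <- Back. auto.
Qed.

(** As [C] has finite index, all points of [X] but finitely many modulo [H] are joined by short
    paths off [P] to elements of [C]. The [f] in [C] for which [f P] meets [P] are finite modulo
    [H]: they lie in finitely many double cosets [H a H] with [a] in [C]. *)
Lemma side_far (P X C : G -> Prop) : is_subgroup C -> (forall c, C c -> half_comm (H := H) c) ->
  (forall h, H h -> C h) -> finite_vset C (fun _ => True) ->
  (exists r, forall x, P x <-> nbhd r x) -> side P X -> ~ finite_vset H X ->
  exists f, C f /\ X f /\ forall p, P p -> ~ P (f ** p).
Proof.
  intros HC Ccomm HHC [l Hl] [r HP] [XP HX] Xinf. apply NNPP; intros N. apply Xinf.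
  destruct (word_length_bound Sg (map ginv l) HS) as [D HD].
  destruct (ball_list Sg D) as [bD HbD]. destruct (ball_list Sg r) as [br Hbr].
  set (near := fun x => exists u, In u bD /\ P (x ** u)).
  set (PP := fun f => C f /\ exists p, P p /\ P (f ** p)).
  assert (FP : finite_vset H P).
  { refine (finite_vset_sub _ _ _ _ (nbhd_finite r)). intros x; apply HP. }
  assert (FPP : finite_vset H PP).
  { apply finite_vset_sub with (Z' := fun f => exists ab, In ab (list_prod br br) /\
      C f /\ exists h h', H h /\ H h' /\ f = h ** (fst ab ** (snd ab)^-1) ** h').
    - intros f [Cf [p [Pp Pfp]]]. apply HP in Pp as [h [w [Hh [F [L ->]]]]].
      apply HP in Pfp as [h' [w' [Hh' [F' [L' E]]]]].
      exists (wprod w', wprod w). split; [apply in_prod; auto|]. split; auto.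
      exists h', (h^-1). repeat split; try mem. simpl.
      apply (f_equal (fun x => x ** (wprod w)^-1 ** h^-1)) in E. revert E; grp; auto.
    - apply finite_vset_union_list. intros [a b] _; simpl.
      destruct (classic (C (a ** b^-1))) as [Cab|Nab].
      + destruct (Ccomm _ Cab) as [m Hm]. exists m. intros f [Cf [h [h' [Hh [Hh' ->]]]]].
        destruct (Hm (a ** b^-1 ** h')) as [x [Hx Ex]]; eauto. exists x; split; auto.
        unfold same_rcoset in *. mem_as (h ** (a ** b^-1 ** h' ** x^-1)).
      + exists []. intros f [Cf [h [h' [Hh [Hh' E]]]]]. exfalso; apply Nab.
        apply HHC in Hh, Hh'. rewrite E in Cf. mem_as (h^-1 ** (h ** (a ** b^-1) ** h') ** h'^-1). }
  apply finite_vset_sub with (Z' := fun x => near x \/ exists y, In y l /\ PP (x ** y^-1)).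
  - intros x Xx. destruct (classic (near x)) as [|Nn]; [now left|right].
    destruct (Hl x I) as [y [Hy Cy]]. exists y. split; auto. split; auto.
    apply NNPP; intros NPP. apply N. exists (x ** y^-1). split; [auto|split].
    (* The path from [x] to [x y^-1] has length at most [D] and misses [P], as [x] is not near [P];
       so it stays in the side [X]. *)
    + destruct (HD (y^-1)) as [w [F [L ->]]]; [now apply in_map|]. clear NPP Cy.
      induction w as [|s w IH] using rev_ind; [simpl; now rewrite gone_r|].
      apply Forall_app in F as [Fw Fs]. inversion Fs; subst.
      assert (Lw : length w <= D) by (rewrite length_app in L; lia).
      assert (Q : ~ P (x ** wprod (w ++ [s]))).
      { intros Q. apply Nn. exists (wprod (w ++ [s])). split; auto.
        apply HbD; auto. apply Forall_app; auto. }
      rewrite wprod_app in *; simpl in *; rewrite gone_r, gassoc in *. auto.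
    + intros p Pp Pfp. apply NPP; eauto.
  - apply finite_vset_union; apply finite_vset_union_list; intros a _.
    + now apply finite_vset_shift.
    + now apply finite_vset_shift.
Qed.

Lemma conn_avoid_snoc K u x y : conn_avoid H Sg K u x -> cdist_le H Sg x y 1 ->
  outside H K y -> conn_avoid H Sg K u y.
Proof.
  induction 1 as [u Hu|u v w Hu Huv Hvw IH]; intros D O.
  - eapply ca_step; eauto. now constructor.
  - eapply ca_step; eauto.
Qed.

Lemma cdist_letter x s : letter Sg s -> cdist_le H Sg x (x ** s) 1.
Proof.
  intros Hs. exists [s], gone. repeat split; auto; [mem|simpl; grp].
Qed.

Lemma cdist_sym x y n : cdist_le H Sg x y n -> cdist_le H Sg y x n.
Proof.
  intros [w [h [F [L [Hh E]]]]]. destruct (word_inv Sg w F) as [w' [F' [L' E']]].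
  exists w', (h^-1). repeat split; auto; [lia|mem|]. rewrite E'.
  apply (f_equal (fun z => h^-1 ** z ** (wprod w)^-1)) in E. revert E; grp; auto.
Qed.

Lemma translation_exists C : is_subgroup C -> (forall c, C c -> half_comm (H := H) c) ->
  (forall h, H h -> C h) -> finite_vset C (fun _ => True) -> at_least_two_ends H Sg ->
  exists t, C t /\ forall n, ~ H (npow t (1 + n)).
Proof.
  intros HC Ccomm HHC FC [K [u [v [Ou [Ov [Nuv [Iu Iv]]]]]]].
  destruct nbhd_connected as [r0 Hr0].
  destruct (word_length_bound Sg K HS) as [rK HrK].
  (* The summand [r0] makes [P] connected, and [rK] makes it contain the cosets of [K]. *)
  set (r := r0 + rK). set (P := nbhd r).
  assert (P1 : P gone) by (apply nbhd_mem; mem).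
  assert (PK : forall x, ~ P x -> outside H K x).
  { intros x Nx k Hk E. apply Nx. destruct (HrK k Hk) as [w [F [L Ek]]].
    exists (x ** k^-1), w. repeat split; auto; [unfold r; lia|]. rewrite <- Ek. grp. }
  set (A := conn_avoid H Sg K u).
  (* [X] comes from the component of [u], and [Y] is everything else off [P]; [Y] is infinite
     because it contains the component of [v] outside [P]. *)
  set (X := fun x => A x /\ ~ P x). set (Y := fun x => ~ A x /\ ~ P x).
  assert (HX : side P X).
  { split; [now intros x []|]. intros x s [Ax _] Ls NP. split; auto.
    apply conn_avoid_snoc with x; auto using cdist_letter. }
  assert (HY : side P Y).
  { split; [now intros x []|]. intros x s [Nx NPx] Ls NP. split; auto.
    intros Axs. apply Nx. apply conn_avoid_snoc with (x ** s); auto.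
    apply cdist_sym, cdist_letter; auto. }
  assert (IX : ~ finite_vset H X).
  { intros F. apply Iu.
    refine (finite_vset_sub _ _ _ _ (finite_vset_union _ _ _ F (nbhd_finite r))).
    intros x Hx. destruct (classic (P x)); [now right|left; now split]. }
  assert (IY : ~ finite_vset H Y).
  { intros F. apply Iv.
    refine (finite_vset_sub _ _ _ _ (finite_vset_union _ _ _ F (nbhd_finite r))).
    intros x Hx. destruct (classic (P x)) as [|NP]; [now right|left; split; auto].
    intros Ax. apply Nuv. clear - Ax Hx HH.
    induction Hx as [|v y x Ov Dvy Hyx IH]; auto.
    apply conn_avoid_snoc with y; auto using cdist_sym. }
  assert (Cases : forall x, ~ P x -> X x \/ Y x).
  { intros x NP. destruct (classic (A x)); [left|right]; split; auto. }
  assert (XY : forall x, X x -> ~ Y x) by (intros x [] []; auto).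
  (* [f P] is connected and misses [P], so it lies entirely in any side containing [f]. *)
  assert (Sweep : forall Z f, side P Z -> (forall p, P p -> ~ P (f ** p)) -> Z f ->
    forall p, P p -> Z (f ** p)).
  { intros Z f [_ HZ] Off Zf. apply Hr0; [unfold r; lia| |now rewrite gone_r].
    intros x s Ls Px Zx. rewrite gassoc. apply HZ; auto. rewrite gassoc_r; auto. }
  assert (OffV : forall f, (forall p, P p -> ~ P (f ** p)) -> forall p, P p -> ~ P (f^-1 ** p)).
  { intros f Off p Pp Q. apply (Off _ Q). now rewrite gmulKV. }
  (* If [t] carries [Z] and [gone] into [Z], all its positive powers lie in [Z], hence off [P] and
     off [H]. *)
  assert (Power : forall Z t, (forall x, Z x \/ x = gone -> Z (t ** x)) ->
    side P Z -> forall n, ~ H (npow t (1 + n))).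
  { intros Z t Zt [ZP _] n Hn. apply (ZP (npow t (1 + n))); [|now apply nbhd_mem].
    clear Hn. induction n as [|n IH]; simpl in *; apply Zt; auto. }
  assert (NX1 : ~ X gone) by (intros [_ ?]; auto).
  assert (NY1 : ~ Y gone) by (intros [_ ?]; auto).
  destruct (side_far P X C) as [f [Cf [Xf Of]]]; auto; [exists r; reflexivity|].
  destruct (side_far P Y C) as [g [Cg [Yg Og]]]; auto; [exists r; reflexivity|].
  assert (Vf : X (f^-1) \/ Y (f^-1)).
  { apply Cases. rewrite <- (gone_r (f^-1)). auto. }
  assert (Vg : X (g^-1) \/ Y (g^-1)).
  { apply Cases. rewrite <- (gone_r (g^-1)). auto. }
  (* Ping-pong: [f] works if [f^-1] is in [Y], and [g] works if [g^-1] is in [X]. Otherwise [f] maps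
     the complement of [X] into [X] and [g] the complement of [Y] into [Y], so [f g] works. *)
  destruct Vf as [Vf|Vf].
  - destruct Vg as [Vg|Vg].
    + assert (E := side_translate P Y X g P1 HY HX (Sweep Y g HY Og Yg)
        (Sweep X _ HX (OffV g Og) Vg)).
      exists g. split; auto. apply (Power Y); auto.
      intros x [Yx| ->]; apply E; auto. intros Xx; now apply (XY x).
    + assert (Ef := side_translate P X X f P1 HX HX (Sweep X f HX Of Xf)
        (Sweep X _ HX (OffV f Of) Vf)).
      assert (Eg := side_translate P Y Y g P1 HY HY (Sweep Y g HY Og Yg)
        (Sweep Y _ HY (OffV g Og) Vg)).
      exists (f ** g). split; [mem|]. apply (Power X); auto.
      intros x Hx. rewrite gassoc_r. apply Ef. intros Xgx. apply (XY _ Xgx). apply Eg.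
      destruct Hx as [Xx| ->]; auto.
  - assert (E := side_translate P X Y f P1 HX HY (Sweep X f HX Of Xf)
      (Sweep Y _ HY (OffV f Of) Vf)).
    exists f. split; auto. apply (Power X); auto. intros x [Xx| ->]; apply E; auto.
Qed.

End Ends.

(** * Finite generation and conjugates of finite-index subgroups *)

Section FiniteIndexGeneration.
Context {G : Group}.
Implicit Types (A B K N : G -> Prop).

Lemma finite_vset_weaken K K' (Z : G -> Prop) : (forall x, K x -> K' x) ->
  finite_vset K Z -> finite_vset K' Z.
Proof. intros HK [l Hl]. exists l. intros z Hz. destruct (Hl z Hz) as [x []]. exists x; split; auto. apply HK; auto. Qed.

Lemma fin_gen_of_list K (T : list G) : is_subgroup K -> (forall x, In x T -> K x) ->
  (forall x, K x -> exists w, Forall (letter T) w /\ x = wprod w) -> fin_gen_subgroup K.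
Proof.
  intros HK HT HW. assert (FT : Forall K T) by (apply Forall_forall; auto).
  exists T. split; auto. intros h; split; auto. intros [w [F ->]]. eapply word_mem; eauto.
Qed.

Lemma letter_mono (T T' : list G) a : (forall x, In x T -> In x T') -> letter T a -> letter T' a.
Proof. intros HT [Ha|[s [Hs ->]]]; [left; auto|right; eauto]. Qed.

Lemma fin_gen_finite_index A B : is_subgroup A -> is_subgroup B -> (forall x, B x -> A x) ->
  fin_gen_subgroup A -> finite_vset B A -> fin_gen_subgroup B.
Proof.
  intros HA HB BA [T [FT HT]] [l Hl].
  set (l' := gone :: l). set (LT := T ++ map ginv T).
  (* Schreier generators, together with the representatives that lie in [B] *)
  destruct (exact_list B (l' ++ map (fun asb => fst asb ** fst (snd asb) ** (snd (snd asb))^-1)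
    (list_prod l' (list_prod LT l')))) as [T' HT'].
  apply (fin_gen_of_list B T'); auto; [intros x Hx; now apply HT'|].
  assert (BT' : Forall B T') by (apply Forall_forall; intros x Hx; now apply HT').
  (* Reading a word letter by letter keeps it a product over [T'] times a representative [b]. When
     the word has value in [B], the final [b] lies in [B] and is itself in [T']. *)
  assert (W : forall w, Forall (letter T) w -> exists w' b, Forall (letter T') w' /\ In b l' /\
    wprod w = wprod w' ** b).
  { induction w as [|s w IH] using rev_ind; intros F.
    - exists [], gone. repeat split; [constructor|now left|simpl; grp].
    - apply Forall_app in F as [Fw Fs]. inversion Fs; subst.
      destruct (IH Fw) as [w' [b [F' [Hb E]]]].
      assert (As : A s). { apply HT. exists [s]. split; auto. simpl; grp. }
      assert (Ab : A b).
      { assert (A1 : A (wprod w)) by (apply HT; eauto).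
        assert (A2 : A (wprod w')) by (apply BA; eapply word_mem; eauto).
        rewrite E in A1. mem_as ((wprod w')^-1 ** (wprod w' ** b)). }
      destruct (Hl (b ** s)) as [b' [Hb' Eb]]; [mem|]. unfold same_rcoset in Eb.
      exists (w' ++ [b ** s ** b'^-1]), b'. repeat split.
      + apply Forall_app; split; auto. constructor; auto. left. apply HT'. split; auto.
        apply in_app_iff; right. apply in_map_iff. exists (b, (s, b')). split; auto.
        apply in_prod; auto. apply in_prod; [now apply letter_in|now right].
      + now right.
      + rewrite !wprod_app, E. simpl. grp. }
  intros x Hx. destruct (proj1 (HT x) (BA x Hx)) as [w [F ->]].
  destruct (W w F) as [w' [b [F' [Hb E]]]].
  exists (w' ++ [b]). split.
  - apply Forall_app; split; auto. constructor; auto. left. apply HT'. split.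
    + apply in_app_iff; now left.
    + assert (B2 : B (wprod w')) by (eapply word_mem; eauto). rewrite E in Hx.
      mem_as ((wprod w')^-1 ** (wprod w' ** b)).
  - rewrite wprod_app, E; simpl; grp.
Qed.

Lemma fin_gen_extension A B : is_subgroup A -> is_subgroup B -> (forall x, B x -> A x) ->
  fin_gen_subgroup B -> finite_vset B A -> fin_gen_subgroup A.
Proof.
  intros HA HB BA [T [FT HT]] [l Hl]. destruct (exact_list A l) as [l' Hl'].
  rewrite Forall_forall in FT.
  apply (fin_gen_of_list A (T ++ l')); auto.
  - intros x Hx. apply in_app_iff in Hx as [Hx|Hx]; [auto|now apply Hl'].
  - intros x Hx. destruct (Hl x Hx) as [y [Hy Ey]]. unfold same_rcoset in Ey.
    destruct (proj1 (HT _) Ey) as [w [F E]]. exists (w ++ [y]). split.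
    + apply Forall_app; split.
      * revert F. apply Forall_impl. intros a. apply letter_mono. intros; apply in_app_iff; auto.
      * constructor; auto. left. apply in_app_iff; right. apply Hl'. split; auto.
        apply BA in Ey. mem_as ((x ** y^-1)^-1 ** x).
    + rewrite wprod_app, <- E; simpl; grp.
Qed.

(* A finitely generated group has finitely many actions on a set of given finite size,
   so two of the conjugates [t^-k K t^k] coincide. *)
Lemma conjugates_coincide N K t : is_subgroup N -> is_subgroup K -> (forall x, K x -> N x) ->
  fin_gen_subgroup N -> finite_vset K N ->
  (forall k n, N n -> N (zpow t k ** n ** (zpow t k)^-1)) ->
  exists m, (0 < m)%Z /\ forall h, N h -> (K h <-> K (zpow t m ** h ** (zpow t m)^-1)).
Proof.
  intros HN HK KN [T [FT HT]] [l0 Hl0] Nt.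
  destruct (exact_list N l0) as [l1 Hl1]. set (l := gone :: l1).
  assert (Nl : forall x, In x l -> N x).
  { intros x [<-|Hx]; [mem|now apply Hl1]. }
  assert (Hl : forall n, N n -> exists x, In x l /\ K (n ** x^-1)).
  { intros n Hn. destruct (Hl0 n Hn) as [x [Hx Ex]]. exists x. split; auto. right. apply Hl1.
    split; auto. apply KN in Ex. mem_as ((n ** x^-1)^-1 ** n). }
  set (cj := fun k n => zpow t (Z.of_nat k) ** n ** (zpow t (Z.of_nat k))^-1).
  (* [K (a n b^-1)] says that right translation by [n] sends [K a] to [K b]; the list indexes the
     finite table of the action of the conjugated generators. *)
  destruct (agreeing_indices (fun k asb => K (fst asb ** cj k (fst (snd asb)) ** (snd (snd asb))^-1))
    (list_prod l (list_prod (T ++ map ginv T) l))) as [k [k' [L E]]].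
  assert (W : forall w, Forall (letter T) w -> forall a b, In a l -> In b l ->
    (K (a ** cj k (wprod w) ** b^-1) <-> K (a ** cj k' (wprod w) ** b^-1))).
  { induction 1 as [|s w Ls Fw IH]; intros a b Ha Hb; simpl.
    - unfold cj. grp.
    - assert (Ns : N s). { apply HT. exists [s]. split; auto. simpl; grp. }
      assert (Na := Nl a Ha). assert (Ncj : N (cj k s)) by (apply Nt; auto).
      destruct (Hl (a ** cj k s)) as [c [Hc Kc]]; [mem|].
      assert (Kc' : K (a ** cj k' s ** c^-1)).
      { apply (E (a, (s, c))); auto. apply in_prod; auto. apply in_prod; auto.
        now apply letter_in. }
      assert (X : forall j, K (a ** cj j s ** c^-1) ->
        (K (a ** cj j (s ** wprod w) ** b^-1) <-> K (c ** cj j (wprod w) ** b^-1))).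
      { intros j Kj. split; intros Q.
        - mem_as ((a ** cj j s ** c^-1)^-1 ** (a ** cj j (s ** wprod w) ** b^-1)).
          unfold cj; grp.
        - mem_as ((a ** cj j s ** c^-1) ** (c ** cj j (wprod w) ** b^-1)).
          unfold cj; grp. }
      rewrite (X k Kc), (X k' Kc'). apply IH; auto. }
  exists (Z.of_nat k' - Z.of_nat k)%Z. split; [lia|]. intros h Hh.
  (* Chosen so that [cj k n = h], while [cj k' n] is the conjugate of [h] by the power [k' - k] of
     [t]. *)
  set (n := zpow t (- Z.of_nat k) ** h ** (zpow t (- Z.of_nat k))^-1).
  assert (Nn : N n) by (apply Nt; auto).
  destruct (proj1 (HT n) Nn) as [w [F Ew]].
  assert (Q := W w F gone gone (or_introl eq_refl) (or_introl eq_refl)).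
  rewrite <- Ew in Q. unfold cj, n in Q. rewrite zpow_opp in Q. autorewrite with grp in Q.
  rewrite zpow_sub. autorewrite with grp. exact Q.
Qed.

End FiniteIndexGeneration.

(** * Coordinates on the coset space and the flux homomorphism *)

Section Sums.
Context {A B : Type}.

Definition sumZ {A : Type} (f : A -> Z) (l : list A) : Z := fold_right (fun a s => (f a + s)%Z) 0%Z l.

Lemma sumZ_permutation (f : A -> Z) l l' : Permutation l l' -> sumZ f l = sumZ f l'.
Proof. unfold sumZ. induction 1; simpl; lia. Qed.

Lemma sumZ_filter (f : A -> Z) l :
  sumZ f (filter (fun a => negb (f a =? 0)%Z) l) = sumZ f l.
Proof.
  unfold sumZ. induction l as [|a l IH]; simpl; auto.
  destruct (Z.eqb_spec (f a) 0); simpl; lia.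
Qed.

Lemma sumZ_map (f : B -> Z) (g : A -> B) l :
  sumZ f (map g l) = sumZ (fun a => f (g a)) l.
Proof. unfold sumZ. induction l; simpl; auto. lia. Qed.

Lemma sumZ_ext (f g : A -> Z) l : (forall a, In a l -> f a = g a) -> sumZ f l = sumZ g l.
Proof. unfold sumZ. induction l; simpl; intros E; auto. rewrite E, IHl; auto. Qed.

Lemma sumZ_add (f g : A -> Z) l : sumZ (fun a => (f a + g a)%Z) l = (sumZ f l + sumZ g l)%Z.
Proof. unfold sumZ. induction l; simpl; lia. Qed.

Lemma sumZ_one (l : list A) : sumZ (fun _ => 1%Z) l = Z.of_nat (length l).
Proof. unfold sumZ. induction l as [|a l IH]; cbn [fold_right length]; lia. Qed.

End Sums.

(** * Coordinates along the orbits of [t] in [H\C] *)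

Section Lines.
Context {G : Group} {H C : G -> Prop} {t : G}.
Context (HH : is_subgroup H) (HC : is_subgroup C) (HHC : forall h, H h -> C h).
Context (Ccomm : forall c, C c -> half_comm (H := H) c).
Context (Ct : C t) (tH : forall n, ~ H (npow t (1 + n))).

Lemma zpow_notin k : H (zpow t k) -> k = 0%Z.
Proof.
  intros Hk. destruct k as [|p|p]; auto; exfalso.
  - apply (tH (Pos.to_nat p - 1)). replace (1 + _) with (Pos.to_nat p) by lia. exact Hk.
  - apply (tH (Pos.to_nat p - 1)). replace (1 + _) with (Pos.to_nat p) by lia.
    simpl in Hk. rewrite <- (ginvK (npow t _)). mem.
Qed.

(** If [x = c t^k c^-1] is in [H], all [c^-1 x^j] lie in [c^-1 H], which meets finitely many right
    cosets of [H]. Two of them agree modulo [H], so [t^(k (j' - j))] lies in [H] and [k = 0]. *)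
Lemma conj_zpow_notin c k : C c -> H (c ** zpow t k ** c^-1) -> k = 0%Z.
Proof.
  intros Hc. set (x := c ** zpow t k ** c^-1). intros Hx.
  assert (E : forall j : nat, c^-1 ** npow x j = zpow t (k * Z.of_nat j) ** c^-1).
  { induction j as [|j IH]; [rewrite Z.mul_0_r; simpl; grp|].
    replace (k * Z.of_nat (S j))%Z with (k + k * Z.of_nat j)%Z by lia.
    rewrite zpow_add, gassoc_r, <- IH. simpl. unfold x. grp. }
  assert (Hj : forall j, H (npow x j)) by (induction j; simpl; mem).
  destruct (Ccomm (c^-1)) as [l Hl]; [mem|].
  destruct (infinite_pigeonhole (fun j z => H (c^-1 ** npow x j ** z^-1)) l)
    as [j [j' [z [L [Ej Ej']]]]].
  { intros j. apply Hl. eauto. }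
  rewrite E in Ej, Ej'.
  assert (Q : H (zpow t (k * Z.of_nat j' - k * Z.of_nat j))).
  { rewrite zpow_sub. mem_as ((zpow t (k * Z.of_nat j') ** c^-1 ** z^-1) **
      (zpow t (k * Z.of_nat j) ** c^-1 ** z^-1)^-1). }
  apply zpow_notin in Q. nia.
Qed.

Lemma line_infinite c : C c -> ~ finite_vset H (dcoset (H := H) (zpowers t) c).
Proof.
  intros Hc [l Hl].
  destruct (infinite_pigeonhole (fun k z => H (c ** zpow t (Z.of_nat k) ** z^-1)) l)
    as [k [k' [z [L [E E']]]]].
  { intros k. apply Hl. exists gone, (zpow t (Z.of_nat k)).
    repeat split; [mem|eexists; reflexivity|grp]. }
  assert (Q : H (c ** zpow t (Z.of_nat k' - Z.of_nat k) ** c^-1)).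
  { rewrite zpow_sub. mem_as ((c ** zpow t (Z.of_nat k') ** z^-1) **
      (c ** zpow t (Z.of_nat k) ** z^-1)^-1). }
  apply conj_zpow_notin in Q; auto. lia.
Qed.

Context {xs : list G} (Cxs : Forall C xs).
Context (Dxs : ForallOrdPairs (fun x y => ~ dcoset (H := H) (zpowers t) x y) xs).
Context (Cov : forall x, C x -> exists y, In y xs /\ dcoset (H := H) (zpowers t) y x).

(* The pair [(k, i)] stands for the coset [H x_i t^k]. *)
Definition elt (v : Z * nat) : G := nth (snd v) xs gone ** zpow t (fst v).
Definition valid (v : Z * nat) : Prop := snd v < length xs.
Definition co (x : G) : Z * nat :=
  epsilon (inhabits (0%Z, 0)) (fun v => valid v /\ H (x ** (elt v)^-1)).
Definition pos (x : G) : Z := fst (co x).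
Definition act (c : G) (v : Z * nat) : Z * nat := co (elt v ** c).

Lemma nth_C i : i < length xs -> C (nth i xs gone).
Proof. intros L. rewrite Forall_forall in Cxs. apply Cxs, nth_In; auto. Qed.

Lemma elt_C v : valid v -> C (elt v).
Proof.
  intros Hv. assert (X := nth_C _ Hv). assert (Y := zpow_mem C t (fst v) HC Ct).
  unfold elt. mem.
Qed.

Lemma nth_separated i j : i < j < length xs ->
  ~ dcoset (H := H) (zpowers t) (nth i xs gone) (nth j xs gone).
Proof.
  clear Cxs Cov. revert i j. induction Dxs as [|a l Ha Hl IH]; intros i j L; simpl in *; [lia|].
  destruct j as [|j]; [lia|]. destruct i as [|i].
  - rewrite Forall_forall in Ha. apply Ha, nth_In; lia.
  - apply IH; auto; lia.
Qed.

Lemma elt_inj v v' : valid v -> valid v' -> H (elt v ** (elt v')^-1) -> v = v'.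
Proof.
  destruct v as [k i], v' as [k' i']. unfold valid, elt; simpl. intros V V' E.
  assert (Ei : i = i').
  { destruct (Nat.lt_trichotomy i i') as [L|[L|L]]; auto; exfalso.
    - apply (nth_separated i i'); [lia|].
      exists ((nth i xs gone ** zpow t k ** (nth i' xs gone ** zpow t k')^-1)^-1), (zpow t (k - k')).
      split; [mem|]. split; [now exists (k - k')%Z|]. rewrite zpow_sub; grp.
    - apply (nth_separated i' i); [lia|].
      exists (nth i xs gone ** zpow t k ** (nth i' xs gone ** zpow t k')^-1), (zpow t (k' - k)).
      split; [mem|]. split; [now exists (k' - k)%Z|]. rewrite zpow_sub; grp. }
  subst i'. f_equal.
  assert (Q : H (nth i xs gone ** zpow t (k - k') ** (nth i xs gone)^-1)).
  { rewrite zpow_sub. refine (eq_ind _ H E _ _). grp. }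
  apply conj_zpow_notin in Q; [lia|]. now apply nth_C.
Qed.

Lemma co_spec x : C x -> valid (co x) /\ H (x ** (elt (co x))^-1).
Proof.
  intros Hx. unfold co. apply epsilon_spec.
  destruct (Cov x Hx) as [y [Hy [h [q [Hh [[k ->] ->]]]]]].
  destruct (In_nth _ _ gone Hy) as [i [Li Ei]]. exists (k, i). split; [exact Li|].
  unfold elt; simpl. rewrite Ei. mem_as h.
Qed.

Lemma co_unique x v : C x -> valid v -> H (x ** (elt v)^-1) -> co x = v.
Proof.
  intros Hx Hv E. destruct (co_spec x Hx) as [Vc Ec]. apply elt_inj; auto.
  mem_as ((x ** (elt (co x))^-1)^-1 ** (x ** (elt v)^-1)).
Qed.

Lemma co_elt v : valid v -> co (elt v) = v.
Proof. intros Hv. apply co_unique; auto using elt_C. mem_as gone. Qed.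

Lemma co_coset x y : C x -> C y -> H (x ** y^-1) -> co x = co y.
Proof.
  intros Hx Hy E. destruct (co_spec y Hy) as [Vy Ey]. apply co_unique; auto.
  mem_as ((x ** y^-1) ** (y ** (elt (co y))^-1)).
Qed.

Lemma co_eq x y : C x -> C y -> co x = co y -> H (x ** y^-1).
Proof.
  intros Hx Hy E. destruct (co_spec x Hx) as [_ Ex]. destruct (co_spec y Hy) as [_ Ey].
  rewrite E in Ex. mem_as ((x ** (elt (co y))^-1) ** (y ** (elt (co y))^-1)^-1).
Qed.

Lemma valid_co x : C x -> valid (co x).
Proof. intros Hx. now apply co_spec. Qed.

Lemma co_mul x c : C x -> C c -> co (elt (co x) ** c) = co (x ** c).
Proof.
  intros Hx Hc. destruct (co_spec x Hx) as [V E]. assert (X := elt_C _ V).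
  symmetry. apply co_coset; [mem|mem|]. refine (eq_ind _ H E _ _). grp.
Qed.

Lemma co_zpow x k : C x -> co (x ** zpow t k) = ((pos x + k)%Z, snd (co x)).
Proof.
  intros Hx. assert (Tk := zpow_mem C t k HC Ct).
  destruct (co_spec x Hx) as [V E]. apply co_unique; [mem|exact V|].
  unfold elt in *; simpl. rewrite zpow_add. unfold pos. refine (eq_ind _ H E _ _). grp.
Qed.

Lemma pos_zpow x k : C x -> pos (x ** zpow t k) = (pos x + k)%Z.
Proof. intros Hx. unfold pos at 1. now rewrite co_zpow. Qed.

Lemma pos_coset x y : C x -> C y -> H (x ** y^-1) -> pos x = pos y.
Proof. intros Hx Hy E. unfold pos. now rewrite (co_coset x y). Qed.

Lemma line_decomposition x : C x ->
  exists y, In y xs /\ H (x ** (y ** zpow t (pos x))^-1) /\ pos y = 0%Z.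
Proof.
  intros Hx. destruct (co_spec x Hx) as [V E]. exists (nth (snd (co x)) xs gone).
  split; [now apply nth_In|]. split; [exact E|].
  assert (Q := co_elt (0%Z, snd (co x)) V). unfold elt in Q; simpl in Q.
  rewrite gone_r in Q. unfold pos. now rewrite Q.
Qed.

(** Left translation by [a] need not descend to [H\C], but [a H] meets only finitely many cosets
    [H z]. If [e = h y t^k], then [a e] lies in some [H z y t^k], whose position is
    [pos (z y) + k]. *)
Lemma pos_translate_bound a : C a ->
  exists D, (0 <= D)%Z /\ forall e, C e -> (Z.abs (pos (a ** e) - pos e) <= D)%Z.
Proof.
  intros Ha. destruct (Ccomm a Ha) as [l Hl].
  destruct (Zbound (fun zy => pos (fst zy ** snd zy)) (list_prod l xs)) as [D [D0 HD]].
  exists D. split; auto. intros e He.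
  destruct (line_decomposition e He) as [y [Hy [E _]]].
  set (k := pos e) in *. set (h := e ** (y ** zpow t k)^-1) in *.
  destruct (Hl (a ** h)) as [z [Hz Ez]]; eauto. unfold same_rcoset in Ez.
  specialize (HD (z, y) (in_prod _ _ _ _ Hz Hy)); simpl in HD.
  assert (Cy : C y) by (rewrite Forall_forall in Cxs; auto).
  assert (Ch := HHC _ E). assert (Cz : C z).
  { apply HHC in Ez. mem_as ((a ** h ** z^-1)^-1 ** a ** h). }
  assert (Tk := zpow_mem C t k HC Ct).
  rewrite (pos_coset (a ** e) (z ** y ** zpow t k)); [|mem|mem|].
  - rewrite pos_zpow by mem. replace (_ + k - k)%Z with (pos (z ** y)) by lia. exact HD.
  - refine (eq_ind _ H Ez _ _). unfold h. grp.
Qed.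

Lemma pos_translate_bound_list (l : list G) : (forall a, In a l -> C a) ->
  exists D, (0 <= D)%Z /\ forall a e, In a l -> C e -> (Z.abs (pos (a ** e) - pos e) <= D)%Z.
Proof.
  induction l as [|b l IH]; intros Hl.
  - exists 0%Z; split; [lia|intros ? ? []].
  - destruct IH as [D [D0 HD]]; [intros; apply Hl; now right|].
    destruct (pos_translate_bound b) as [D' [D0' HD']]; [apply Hl; now left|].
    exists (D + D')%Z. split; [lia|]. intros a e [<-|Ha] He.
    + specialize (HD' e He); lia.
    + specialize (HD a e Ha He); lia.
Qed.

(** * Right translations and the two ends of [H\C] *)

Definition box (N : Z) : list (Z * nat) :=
  list_prod (map (fun i => (Z.of_nat i - N)%Z) (seq 0 (Z.to_nat (2 * N + 1)))) (seq 0 (length xs)).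

Lemma box_in N v : valid v -> (Z.abs (fst v) <= N)%Z -> In v (box N).
Proof.
  destruct v as [k i]; unfold valid; simpl; intros V L. apply in_prod.
  - apply in_map_iff. exists (Z.to_nat (k + N)). split; [lia|]. apply in_seq; lia.
  - apply in_seq; lia.
Qed.

Lemma pos_bounded c N : C c ->
  exists N', forall y, C y -> (Z.abs (pos y) <= N)%Z -> (Z.abs (pos (y ** c)) <= N')%Z.
Proof.
  intros Hc. destruct (Zbound (fun v => pos (elt v ** c)) (box N)) as [D [_ HD]].
  exists D. intros y Hy L. unfold pos. rewrite <- co_mul by auto.
  apply (HD (co y)). apply box_in; auto using valid_co.
Qed.

Lemma pos_proper c N : C c ->
  exists N', forall y, C y -> (N' < Z.abs (pos y))%Z -> (N < Z.abs (pos (y ** c)))%Z.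
Proof.
  intros Hc. destruct (pos_bounded (c^-1) N) as [N' HN']; [mem|]. exists N'.
  intros y Hy L. apply Z.nle_gt; intros L'.
  assert (Q := HN' (y ** c) ltac:(mem) L'). revert Q; grp. lia.
Qed.

(* [good c]: right translation by [c] fixes both ends of the coset space [H\C];
   [anti c]: it exchanges them. *)
Definition good (c : G) : Prop := forall B, exists M, forall x, C x ->
  ((M <= pos x)%Z -> (B <= pos (x ** c))%Z) /\ ((pos x <= - M)%Z -> (pos (x ** c) <= - B)%Z).

Definition anti (c : G) : Prop := forall B, exists M, forall x, C x ->
  ((M <= pos x)%Z -> (pos (x ** c) <= - B)%Z) /\ ((pos x <= - M)%Z -> (B <= pos (x ** c))%Z).

(** Along the powers of [t], [q k = pos (t^k c)] changes by at most [D] at each step, while far out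
    [|q k| > D]; so its sign is constant near each end. The other lines follow because left
    translation by an element of [xs] also changes [pos] by at most [D]. *)
Lemma pos_sign c : C c -> exists M, (0 <= M)%Z /\
  ((forall x, C x -> (M <= pos x)%Z -> (0 < pos (x ** c))%Z) \/
   (forall x, C x -> (M <= pos x)%Z -> (pos (x ** c) < 0)%Z)) /\
  ((forall x, C x -> (pos x <= - M)%Z -> (0 < pos (x ** c))%Z) \/
   (forall x, C x -> (pos x <= - M)%Z -> (pos (x ** c) < 0)%Z)).
Proof.
  intros Hc.
  destruct (pos_translate_bound_list (t :: xs)) as [D [D0 HD]].
  { intros a [<-|Ha]; auto. rewrite Forall_forall in Cxs; auto. }
  destruct (pos_proper c D Hc) as [N HN].
  assert (C1 : C gone) by mem.
  assert (Tk : forall k, C (zpow t k)) by (intros; now apply zpow_mem).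
  set (p1 := pos gone).
  assert (Pk : forall k, pos (zpow t k) = (p1 + k)%Z).
  { intros k. rewrite <- (gone_l G (zpow t k)). now apply pos_zpow. }
  (* Large enough that [|k| >= M] puts both [k] and [p1 + k] beyond [N] in absolute value. *)
  set (M := (Z.abs N + 2 * Z.abs p1 + 1)%Z).
  set (q := fun k => pos (zpow t k ** c)).
  assert (Big : forall k, (N < Z.abs (p1 + k) -> D < Z.abs (q k))%Z).
  { intros k L. apply HN; auto. now rewrite Pk. }
  assert (Step : forall k, (Z.abs (q (k + 1) - q k) <= D)%Z).
  { intros k. unfold q. rewrite zpow_succ, gassoc_r. apply HD; [now left|mem]. }
  assert (Cl : forall x, C x -> (Z.abs (pos (x ** c) - q (pos x)) <= D)%Z).
  { intros x Hx. destruct (line_decomposition x Hx) as [y [Hy [E _]]].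
    assert (Cy : C y) by (rewrite Forall_forall in Cxs; auto).
    rewrite (pos_coset (x ** c) (y ** (zpow t (pos x) ** c))).
    - apply HD; [now right|]. specialize (Tk (pos x)); mem.
    - mem.
    - specialize (Tk (pos x)); mem.
    - refine (eq_ind _ H E _ _). grp. }
  assert (Up : forall n : nat, (0 < q M -> 0 < q (M + Z.of_nat n))%Z /\
                               (q M < 0 -> q (M + Z.of_nat n) < 0)%Z).
  { induction n as [|n IH]; [rewrite Z.add_0_r; tauto|].
    assert (S1 := Step (M + Z.of_nat n)%Z). assert (B1 := Big (M + Z.of_nat n)%Z).
    assert (B2 := Big (M + Z.of_nat n + 1)%Z).
    replace (M + Z.of_nat (S n))%Z with (M + Z.of_nat n + 1)%Z by lia. lia. }
  assert (Dn : forall n : nat, (0 < q (- M) -> 0 < q (- M - Z.of_nat n))%Z /\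
                               (q (- M) < 0 -> q (- M - Z.of_nat n) < 0)%Z).
  { induction n as [|n IH]; [rewrite Z.sub_0_r; tauto|].
    assert (S1 := Step (- M - Z.of_nat (S n))%Z). assert (B1 := Big (- M - Z.of_nat (S n))%Z).
    assert (B2 := Big (- M - Z.of_nat n)%Z).
    replace (- M - Z.of_nat (S n) + 1)%Z with (- M - Z.of_nat n)%Z in S1 by lia. lia. }
  assert (BM := Big M ltac:(lia)). assert (BM' := Big (- M)%Z ltac:(lia)).
  exists M. split; [lia|]. split.
  - destruct (Z_lt_le_dec 0 (q M)); [left|right]; intros x Hx L;
      destruct (Up (Z.to_nat (pos x - M))) as [U U'];
      replace (M + Z.of_nat (Z.to_nat (pos x - M)))%Z with (pos x) in U, U' by lia;
      assert (X := Cl x Hx); assert (Y := HN x Hx ltac:(lia));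
      assert (Y' := Big (pos x) ltac:(lia)); clear - U U' X Y Y' BM BM' D0 l; lia.
  - destruct (Z_lt_le_dec 0 (q (- M))%Z); [left|right]; intros x Hx L;
      destruct (Dn (Z.to_nat (- M - pos x))) as [U U'];
      replace (- M - Z.of_nat (Z.to_nat (- M - pos x)))%Z with (pos x) in U, U' by lia;
      assert (X := Cl x Hx); assert (Y := HN x Hx ltac:(lia));
      assert (Y' := Big (pos x) ltac:(lia)); clear - U U' X Y Y' BM BM' D0 l; lia.
Qed.

(** Both ends cannot go to the same end: [pos (x c)] would be bounded on one side, although right
    translation by [c] is onto. *)
Lemma good_or_anti c : C c -> good c \/ anti c.
Proof.
  intros Hc. destruct (pos_sign c Hc) as [M [M0 [Hp Hm]]].
  assert (Pr : forall B, exists M', (M <= M')%Z /\ forall x, C x ->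
    (M' <= Z.abs (pos x))%Z -> (B < Z.abs (pos (x ** c)))%Z).
  { intros B. destruct (pos_proper c B Hc) as [N HN]. exists (M + Z.abs N + 1)%Z.
    split; [lia|]. intros x Hx L. apply HN; auto; lia. }
  destruct (pos_bounded c M Hc) as [N' HN'].
  assert (Onto : forall z, exists x, C x /\ pos (x ** c) = z).
  { intros z. exists (zpow t (z - pos gone) ** c^-1).
    assert (Tk := zpow_mem C t (z - pos gone) HC Ct). split; [mem|].
    rewrite gassoc_r, ginv_l, gone_r, <- (gone_l G (zpow t _)), pos_zpow by mem. lia. }
  destruct Hp as [Hp|Hp], Hm as [Hm|Hm].
  - exfalso. destruct (Onto (- Z.abs N' - 1)%Z) as [x [Hx Ex]].
    specialize (Hp x Hx); specialize (Hm x Hx); specialize (HN' x Hx). lia.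
  - left. intros B. destruct (Pr B) as [M' [L HM']]. exists M'. intros x Hx.
    specialize (Hp x Hx); specialize (Hm x Hx); specialize (HM' x Hx). lia.
  - right. intros B. destruct (Pr B) as [M' [L HM']]. exists M'. intros x Hx.
    specialize (Hp x Hx); specialize (Hm x Hx); specialize (HM' x Hx). lia.
  - exfalso. destruct (Onto (Z.abs N' + 1)%Z) as [x [Hx Ex]].
    specialize (Hp x Hx); specialize (Hm x Hx); specialize (HN' x Hx). lia.
Qed.

Lemma good_mul c d : C c -> good c -> good d -> good (c ** d).
Proof.
  intros Hc Gc Gd B. destruct (Gd B) as [M1 H1]. destruct (Gc M1) as [M2 H2].
  exists M2. intros x Hx. rewrite gassoc.
  specialize (H2 x Hx). specialize (H1 (x ** c) ltac:(mem)). tauto.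
Qed.

Lemma good_anti_mul c d : C c -> good c -> anti d -> anti (c ** d).
Proof.
  intros Hc Gc Gd B. destruct (Gd B) as [M1 H1]. destruct (Gc M1) as [M2 H2].
  exists M2. intros x Hx. rewrite gassoc.
  specialize (H2 x Hx). specialize (H1 (x ** c) ltac:(mem)). tauto.
Qed.

Lemma anti_anti_mul c d : C c -> anti c -> anti d -> good (c ** d).
Proof.
  intros Hc Gc Gd B. destruct (Gd B) as [M1 H1]. destruct (Gc M1) as [M2 H2].
  exists M2. intros x Hx. rewrite gassoc.
  specialize (H2 x Hx). specialize (H1 (x ** c) ltac:(mem)). tauto.
Qed.

Lemma good_one : good gone.
Proof. intros B. exists B. intros x Hx. rewrite gone_r. tauto. Qed.

Lemma not_anti_one : ~ anti gone.
Proof.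
  intros X. destruct (X 1%Z) as [M HM].
  assert (Tk := zpow_mem C t (Z.abs M - pos gone) HC Ct).
  specialize (HM (zpow t (Z.abs M - pos gone)) Tk). rewrite gone_r in HM.
  assert (E := pos_zpow gone (Z.abs M - pos gone) ltac:(mem)). rewrite gone_l in E. lia.
Qed.

Definition C0 (c : G) : Prop := C c /\ good c.

Lemma C0_subgroup : is_subgroup C0.
Proof.
  split; [|split].
  - split; [mem|apply good_one].
  - intros x y [] []. split; [mem|now apply good_mul].
  - intros x [Hx Gx]. split; [mem|]. destruct (good_or_anti (x^-1)) as [|A]; [mem|auto|].
    exfalso. apply not_anti_one. rewrite <- (ginv_r x). now apply good_anti_mul.
Qed.

(** The index is at most two, since [x a^-1] preserves the ends when [x] and [a] both exchange
    them. *)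
Lemma C0_index (K : G -> Prop) : is_subgroup K -> (forall x, K x -> C x) ->
  finite_vset (inter K C0) K.
Proof.
  intros HK KC. assert (HC0 := C0_subgroup).
  destruct (classic (exists a, K a /\ anti a)) as [[a [Ka Aa]]|N].
  - exists [gone; a]. intros x Hx. assert (Cx := KC x Hx). assert (Ca := KC a Ka).
    destruct (good_or_anti x Cx) as [Gx|Ax].
    + exists gone. split; [simpl; auto|]. unfold same_rcoset. grp. repeat split; auto.
    + exists a. split; [simpl; auto|]. unfold same_rcoset. split; [mem|]. split; [mem|].
      apply anti_anti_mul; auto. destruct (good_or_anti (a^-1)) as [Ga|]; [mem| |auto].
      exfalso. apply not_anti_one. rewrite <- (ginv_l G a). apply good_anti_mul; auto. mem.
  - exists [gone]. intros x Hx. exists gone. split; [simpl; auto|].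
    unfold same_rcoset. grp. split; auto. split; auto.
    destruct (good_or_anti x); auto. exfalso; eauto.
Qed.

(** * The flux homomorphism *)

Definition sgn (z : Z) : Z := if (0 <=? z)%Z then 1%Z else 0%Z.
(** As [sgn] is the indicator of the nonnegative integers, this is [1] for a coset entering that
    half, [-1] for one leaving it, and [0] otherwise. *)
Definition crossing (c : G) (v : Z * nat) : Z := (sgn (fst (act c v)) - sgn (fst v))%Z.

(** Cosets that do not cross are allowed in the list, so that one list can serve several
    elements. *)
Definition support_list (c : G) (l : list (Z * nat)) : Prop :=
  NoDup l /\ (forall v, In v l -> valid v) /\
  forall v, valid v -> ~ In v l -> crossing c v = 0%Z.

Lemma support_sum_unique c l l' : support_list c l -> support_list c l' ->
  sumZ (crossing c) l = sumZ (crossing c) l'.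
Proof.
  intros [N [V Z0]] [N' [V' Z0']]. rewrite <- (sumZ_filter _ l), <- (sumZ_filter _ l').
  apply sumZ_permutation, NoDup_Permutation; try now apply NoDup_filter.
  intros v. rewrite !filter_In. split; intros [Hv E]; split; auto; apply NNPP; intros Nv;
    [rewrite Z0' in E by auto|rewrite Z0 in E by auto]; discriminate.
Qed.

Lemma act_valid c v : C c -> valid v -> valid (act c v).
Proof. intros Hc Hv. assert (X := elt_C v Hv). apply valid_co. mem. Qed.

Lemma act_mul c d v : C c -> C d -> valid v -> act (c ** d) v = act d (act c v).
Proof.
  intros Hc Hd Hv. assert (X := elt_C v Hv). unfold act at 2 3.
  rewrite co_mul by mem. unfold act. now rewrite gassoc.
Qed.

Lemma act_one v : valid v -> act gone v = v.
Proof. intros Hv. unfold act. rewrite gone_r. now apply co_elt. Qed.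

Lemma actVK c v : C c -> valid v -> act c (act (c^-1) v) = v.
Proof. intros Hc Hv. rewrite <- act_mul, ginv_l; [now apply act_one|mem|auto|auto]. Qed.

Lemma actKV c v : C c -> valid v -> act (c^-1) (act c v) = v.
Proof. intros Hc Hv. rewrite <- act_mul, ginv_r; [now apply act_one|auto|mem|auto]. Qed.

Lemma act_map_nodup c l : C c -> NoDup l -> (forall v, In v l -> valid v) -> NoDup (map (act c) l).
Proof.
  intros Hc N V. apply NoDup_map_NoDup_ForallPairs; auto.
  intros v v' Hv Hv' E. rewrite <- (actKV c v), <- (actKV c v') by auto. now rewrite E.
Qed.

Lemma support_exists c : C0 c -> exists l, support_list c l.
Proof.
  (* The bound [1] instead of [0] makes images of far negative cosets strictly negative, where [sgn]
     vanishes. *)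
  intros [Hc Gc]. destruct (Gc 1%Z) as [M HM].
  destruct (exact_nodup (fun v => valid v /\ crossing c v <> 0%Z) (box (Z.abs M))) as [l [N Hl]].
  - intros v [Hv Cv]. apply box_in; auto. apply Z.nlt_ge; intros L. apply Cv.
    specialize (HM (elt v) (elt_C v Hv)).
    assert (E : pos (elt v) = fst v) by (unfold pos; now rewrite co_elt).
    rewrite E in HM. unfold crossing, sgn, act. fold (pos (elt v ** c)).
    destruct (Z.leb_spec 0 (pos (elt v ** c))), (Z.leb_spec 0 (fst v)); lia.
  - exists l. split; [auto|split].
    + intros v Hv. now apply Hl.
    + intros v Hv Nv. apply NNPP; intros Cv. apply Nv, Hl; auto.
Qed.

(* The net number of cosets that right translation by [c] carries into [{pos >= 0}]. *)
Definition flux (c : G) : Z :=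
  sumZ (crossing c) (epsilon (inhabits []) (support_list c)).

Lemma flux_eq c l : support_list c l -> flux c = sumZ (crossing c) l.
Proof. intros Hl. unfold flux. apply support_sum_unique; auto. apply epsilon_spec; eauto. Qed.

(** Crossings satisfy a cocycle identity. It is summed over a list [l] containing the support of [c]
    and the preimage under [c] of the support of [d]; its image under [c] then supports [d]. *)
Lemma flux_mul c d : C0 c -> C0 d -> flux (c ** d) = (flux c + flux d)%Z.
Proof.
  intros C0c C0d. assert (Hc : C c) by apply C0c. assert (Hd : C d) by apply C0d.
  destruct (support_exists c C0c) as [lc [Nc [Vc Zc]]].
  destruct (support_exists d C0d) as [ld [Nd [Vd Zd]]].
  destruct (exact_nodup (fun v => In v lc \/ exists u, In u ld /\ v = act (c^-1) u)
    (lc ++ map (act (c^-1)) ld)) as [l [Nl Hl]].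
  { intros v [Hv|[u [Hu ->]]]; apply in_app_iff; auto using in_map. }
  assert (Cross : forall v, valid v -> crossing (c ** d) v = (crossing d (act c v) + crossing c v)%Z).
  { intros v Hv. unfold crossing. rewrite act_mul by auto. lia. }
  assert (Vl : forall v, In v l -> valid v).
  { intros v Hv. apply Hl in Hv as [Hv|[u [Hu ->]]]; auto. apply act_valid; auto. mem. }
  assert (Lc : support_list c l).
  { split; [auto|split]; auto. intros v Hv Nv. apply Zc; auto. intros Q; apply Nv, Hl; auto. }
  assert (Out : forall v, valid v -> ~ In v l -> crossing d (act c v) = 0%Z).
  { intros v Hv Nv. apply Zd; [now apply act_valid|]. intros Q. apply Nv, Hl. right.
    exists (act c v). split; auto. now rewrite actKV. }
  assert (Ld : support_list d (map (act c) l)).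
  { split; [now apply act_map_nodup|split].
    - intros v Hv. apply in_map_iff in Hv as [u [<- Hu]]. apply act_valid; auto.
    - intros v Hv Nv. assert (Vv : valid (act (c^-1) v)) by (apply act_valid; auto; mem).
      rewrite <- (actVK c v) by auto. apply Out; auto. intros Q. apply Nv, in_map_iff.
      exists (act (c^-1) v). split; auto. now apply actVK. }
  assert (Lcd : support_list (c ** d) l).
  { split; [auto|split]; auto. intros v Hv Nv. rewrite Cross, Out by auto.
    destruct Lc as [_ [_ ->]]; auto. }
  rewrite (flux_eq _ _ Lc), (flux_eq _ _ Ld), (flux_eq _ _ Lcd), sumZ_map.
  rewrite Z.add_comm, <- sumZ_add. apply sumZ_ext. intros v Hv. apply Cross; auto.
Qed.

Lemma flux_one : flux gone = 0%Z.
Proof.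
  assert (HC0 := C0_subgroup).
  assert (E := flux_mul gone gone ltac:(mem) ltac:(mem)). rewrite gone_l in E. lia.
Qed.

Lemma flux_inv c : C0 c -> flux (c^-1) = (- flux c)%Z.
Proof.
  intros Hc. assert (HC0 := C0_subgroup).
  assert (E := flux_mul c (c^-1) Hc ltac:(mem)). rewrite ginv_r, flux_one in E. lia.
Qed.

(* Orbits of [H] on [H\C] are finite, and a permutation of a finite set has no flux. *)
Lemma flux_H h : H h -> C0 h -> flux h = 0%Z.
Proof.
  intros Hh C0h. assert (Ch := HHC h Hh).
  destruct (support_exists h C0h) as [lh [Nh [Vh Zh]]].
  assert (Orb : forall lh', (forall u, In u lh' -> valid u) ->
    exists l, forall u k, In u lh' -> H k -> In (act k u) l).
  { induction lh' as [|u lh' IH]; intros V.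
    - exists []. intros _ _ [].
    - destruct IH as [l IHl]; [intros; apply V; now right|].
      assert (Cu : C (elt u)) by (apply elt_C, V; now left).
      destruct (Ccomm _ Cu) as [m Hm]. exists (map co m ++ l).
      intros v k [<-|Hv] Hk; apply in_app_iff; [left|right; now apply IHl].
      destruct (Hm (elt u ** k)) as [x [Hx Ex]]; eauto. unfold same_rcoset in Ex.
      apply in_map_iff. exists x. split; auto.
      assert (Ck := HHC k Hk).
      assert (Cx : C x).
      { assert (Q := HHC _ Ex). mem_as ((elt u ** k ** x^-1)^-1 ** elt u ** k). }
      symmetry. apply co_coset; auto. mem. }
  destruct (Orb lh Vh) as [l Hl].
  (* [l'] is the union of the [H]-orbits meeting the support; [h] permutes it, so the sum of [sgn]
     over it is unchanged. *)
  destruct (exact_nodup (fun v => exists u k, In u lh /\ H k /\ v = act k u) l) as [l' [N' Hl']].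
  { intros v [u [k [Hu [Hk ->]]]]; auto. }
  assert (V' : forall v, In v l' -> valid v).
  { intros v Hv. apply Hl' in Hv as [u [k [Hu [Hk ->]]]]. apply act_valid; auto. }
  assert (Stab : forall k v, H k -> In v l' -> In (act k v) l').
  { intros k v Hk Hv. apply Hl' in Hv as [u [k' [Hu [Hk' ->]]]]. apply Hl'.
    exists u, (k' ** k). repeat split; auto; [mem|]. now rewrite act_mul by auto. }
  assert (L' : support_list h l').
  { split; [auto|split]; auto. intros v Hv Nv. apply Zh; auto. intros Q. apply Nv, Hl'.
    exists v, gone. repeat split; auto; [mem|]. now rewrite act_one. }
  rewrite (flux_eq _ _ L').
  assert (Pm : Permutation l' (map (act h) l')).
  { apply NoDup_Permutation; auto using act_map_nodup. intros v. rewrite in_map_iff. split.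
    - intros Hv. exists (act (h^-1) v). rewrite actVK by auto. split; auto. apply Stab; auto. mem.
    - intros [u [<- Hu]]. now apply Stab. }
  assert (E := sumZ_permutation (fun v => sgn (fst v)) _ _ Pm). rewrite sumZ_map in E.
  assert (E2 := sumZ_add (crossing h) (fun v => sgn (fst v)) l').
  rewrite (sumZ_ext _ (fun v => sgn (fst (act h v)))) in E2; [lia|].
  intros v _. unfold crossing. lia.
Qed.

Lemma C0_t : C0 t.
Proof.
  split; auto. intros B. exists (Z.abs B + 1)%Z. intros x Hx.
  assert (E := pos_zpow x 1 Hx). rewrite zpow_1 in E. lia.
Qed.

Lemma act_t v : valid v -> act t v = ((fst v + 1)%Z, snd v).
Proof.
  intros Hv. unfold act. assert (E := co_zpow (elt v) 1 (elt_C v Hv)).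
  rewrite zpow_1 in E. rewrite E. unfold pos. now rewrite co_elt.
Qed.

(** On each line exactly one coset crosses, the one that moves from position [-1] to [0]. *)
Lemma flux_t : flux t = Z.of_nat (length xs).
Proof.
  assert (L : support_list t (map (fun i => ((-1)%Z, i)) (seq 0 (length xs)))).
  { split; [|split].
    - apply NoDup_map_NoDup_ForallPairs; [|apply seq_NoDup]. intros i j _ _ E. congruence.
    - intros v Hv. apply in_map_iff in Hv as [i [<- Hi]]. apply in_seq in Hi. unfold valid; simpl; lia.
    - intros [k i] Hv Nv. unfold crossing. rewrite act_t by auto. simpl.
      assert (k <> (-1)%Z).
      { intros ->. apply Nv, in_map_iff. exists i; split; auto. apply in_seq. unfold valid in Hv; simpl in Hv; lia. }
      unfold sgn. destruct (Z.leb_spec 0 (k + 1)), (Z.leb_spec 0 k); lia. }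
  rewrite (flux_eq _ _ L), sumZ_map.
  rewrite (sumZ_ext _ (fun _ => 1%Z)).
  - now rewrite sumZ_one, length_seq.
  - intros i Hi. apply in_seq in Hi. unfold crossing.
    rewrite act_t by (unfold valid; simpl; lia). reflexivity.
Qed.

Lemma lines_pos : (0 < Z.of_nat (length xs))%Z.
Proof. destruct (Cov gone) as [y [Hy _]]; [mem|]. destruct xs; [destruct Hy|simpl; lia]. Qed.

Lemma flux_zpow k : flux (zpow t k) = (k * Z.of_nat (length xs))%Z.
Proof.
  assert (HC0 := C0_subgroup).
  assert (X : forall n, flux (npow t n) = (Z.of_nat n * Z.of_nat (length xs))%Z).
  { induction n as [|n IH]; [apply flux_one|].
    change (npow t (S n)) with (t ** npow t n).
    rewrite flux_mul, IH, flux_t; [lia|apply C0_t|].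
    rewrite <- zpow_of_nat. apply zpow_mem; auto. apply C0_t. }
  destruct k as [|p|p].
  - apply flux_one.
  - simpl zpow. rewrite X. lia.
  - simpl zpow. rewrite flux_inv, X; [lia|].
    rewrite <- zpow_of_nat. apply zpow_mem; auto. apply C0_t.
Qed.

(** * Construction of the virtual fiber structure *)

Definition H0 : G -> Prop := inter H C0.

Lemma H0_subgroup : is_subgroup H0.
Proof. apply inter_subgroup; auto using C0_subgroup. Qed.

Definition fluxless (c : G) : Prop := C0 c /\ flux c = 0%Z.

Lemma fluxless_subgroup : is_subgroup fluxless.
Proof.
  assert (HC0 := C0_subgroup). split; [|split].
  - split; [mem|apply flux_one].
  - intros x y [] []. split; [mem|]. rewrite flux_mul; auto; lia.
  - intros x []. split; [mem|]. rewrite flux_inv; auto; lia.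
Qed.

Lemma H0_fluxless h : H0 h -> fluxless h.
Proof. intros [Hh Ch]. split; auto using flux_H. Qed.

Lemma fluxless_conj c n : C0 c -> fluxless n -> fluxless (c ** n ** c^-1).
Proof.
  assert (HC0 := C0_subgroup). intros Hc [Cn Fn]. split; [mem|].
  rewrite !flux_mul, flux_inv by mem. lia.
Qed.

(** Each line carries at most one coset of [H0] made of fluxless elements: if [n] lies in [H m t^d]
    with both [n] and [m] fluxless, then [d] times the number of lines is zero. *)
Lemma H0_index_fluxless : finite_vset H0 fluxless.
Proof.
  assert (HC0 := C0_subgroup).
  set (P := fun i n => fluxless n /\ snd (co n) = i).
  exists (map (fun i => epsilon (inhabits gone) (P i)) (seq 0 (length xs))).
  intros n Hn. assert (C0n : C0 n) by apply Hn. assert (Cn : C n) by apply C0n.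
  exists (epsilon (inhabits gone) (P (snd (co n)))). split.
  - apply in_map_iff. eexists; split; [reflexivity|]. apply in_seq.
    assert (V := valid_co n Cn). unfold valid in V; lia.
  - set (m := epsilon _ _).
    assert (Pm : P (snd (co n)) m) by (apply epsilon_spec; exists n; split; auto).
    destruct Pm as [Hm Em]. assert (C0m : C0 m) by apply Hm. assert (Cm : C m) by apply C0m.
    set (d := (pos n - pos m)%Z).
    assert (C0d : C0 (zpow t d)) by (apply zpow_mem; auto; apply C0_t).
    assert (Cd : C (zpow t d)) by apply C0d.
    assert (E : H (n ** (m ** zpow t d)^-1)).
    { apply co_eq; auto; [mem|]. rewrite co_zpow, Em by auto. unfold d, pos.
      replace (fst (co m) + (fst (co n) - fst (co m)))%Z with (fst (co n)) by lia.
      now destruct (co n). }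
    assert (F : flux (n ** (m ** zpow t d)^-1) = 0%Z) by (apply flux_H; auto; mem).
    destruct Hn as [_ Fn], Hm as [_ Fm].
    rewrite flux_mul, flux_inv, flux_mul, Fn, Fm, flux_zpow in F by mem.
    assert (Lp := lines_pos). assert (D0 : d = 0%Z) by nia.
    rewrite D0 in E. simpl in E. rewrite gone_r in E. split; [exact E|mem].
Qed.

Lemma virtual_fiber_of_lines : fin_gen_subgroup H -> finite_vset C (fun _ => True) ->
  virtual_fiber H.
Proof.
  intros FH FC. assert (HC0 := C0_subgroup). assert (HH0 := H0_subgroup).
  assert (HN := fluxless_subgroup). assert (Lp := lines_pos).
  assert (Tk : forall k, C0 (zpow t k)) by (intros; apply zpow_mem; auto using C0_t).
  assert (FH0 : finite_vset H0 H) by (apply C0_index; auto).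
  destruct (conjugates_coincide fluxless H0 t) as [m [m0 Hm]]; auto using H0_fluxless, H0_index_fluxless.
  { apply (fin_gen_extension fluxless H0); auto using H0_fluxless, H0_index_fluxless.
    apply (fin_gen_finite_index H H0); auto. now intros x []. }
  { intros k n Hn. now apply fluxless_conj. }
  set (p := Z.of_nat (length xs)) in *.
  assert (Conj : forall j h, H0 h -> H0 (zpow t (m * j) ** h ** (zpow t (m * j))^-1)).
  { intros j. induction j as [|j IH|j IH] using Z.peano_ind; intros h Hh.
    - rewrite Z.mul_0_r. simpl. now autorewrite with grp.
    - replace (m * Z.succ j)%Z with (m + m * j)%Z by lia. rewrite zpow_add.
      assert (Q := IH h Hh). apply Hm in Q; [|now apply H0_fluxless].
      refine (eq_ind _ H0 Q _ _). grp.
    (* Descending to negative multiples uses the converse direction of [Hm]. *)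
    - assert (Q := IH h Hh).
      apply Hm; [apply fluxless_conj; auto using H0_fluxless|].
      refine (eq_ind _ H0 Q _ _). replace (m * j)%Z with (m + m * Z.pred j)%Z by lia.
      rewrite zpow_add. grp. }
  (* The semidirect product of [H0] with the cyclic group generated by [t^m]. *)
  set (G' := fun x => exists j h, H0 h /\ x = h ** zpow t (m * j)).
  assert (FluxG : forall j h, H0 h -> flux (h ** zpow t (m * j)) = (j * (m * p))%Z).
  { intros j h Hh. destruct (H0_fluxless h Hh) as [C0h Fh].
    rewrite flux_mul, flux_zpow, Fh; auto. fold p. lia. }
  assert (HG' : is_subgroup G').
  { split; [|split].
    - exists 0%Z, gone. split; [mem|]. rewrite Z.mul_0_r; simpl; grp.
    - intros x y [j [h [Hh ->]]] [j' [h' [Hh' ->]]].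
      exists (j + j')%Z, (h ** (zpow t (m * j) ** h' ** (zpow t (m * j))^-1)).
      assert (Q := Conj j h' Hh'). split; [mem|].
      rewrite Z.mul_add_distr_l, zpow_add; grp.
    - intros x [j [h [Hh ->]]].
      exists (- j)%Z, (zpow t (m * - j) ** h^-1 ** (zpow t (m * - j))^-1).
      split; [apply Conj; mem|]. rewrite Z.mul_opp_r, zpow_opp. grp. }
  assert (FG' : finite_vset G' C0).
  (* Multiplication by a power of [t^m] brings the flux into [[0, q)]; comparison with a fixed
     element [r i] of the same flux leaves a fluxless element. *)
  { destruct H0_index_fluxless as [ln Hln]. set (q := (m * p)%Z). assert (q0 : (0 < q)%Z) by nia.
    set (P := fun i c => C0 c /\ flux c = Z.of_nat i).
    set (r := fun i => epsilon (inhabits gone) (P i)).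
    exists (flat_map (fun i => map (fun y => y ** r i) ln) (seq 0 (Z.to_nat q))).
    intros c Hc. set (j := (flux c / q)%Z). set (i := Z.to_nat (flux c mod q)).
    assert (Bi := Z.mod_pos_bound (flux c) q q0). assert (Ed := Z.div_mod (flux c) q ltac:(lia)).
    set (x := (zpow t (m * j))^-1 ** c).
    assert (Cx : C0 x) by (assert (Q := Tk (m * j)%Z); unfold x; mem).
    assert (Fx : flux x = Z.of_nat i).
    { unfold x. rewrite flux_mul, flux_inv, flux_zpow by mem. fold p. unfold i, j.
      rewrite Z2Nat.id by lia. unfold q in *. nia. }
    assert (Pr : P i (r i)) by (apply epsilon_spec; exists x; split; auto).
    destruct Pr as [Cr Fr].
    destruct (Hln (x ** (r i)^-1)) as [y [Hy Ey]].
    { split; [mem|]. rewrite flux_mul, flux_inv by mem. lia. }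
    exists (y ** r i). split.
    - apply in_flat_map. exists i. split; [apply in_seq; unfold i; lia|]. apply in_map_iff; eauto.
    - exists j, (zpow t (m * j) ** (x ** (r i)^-1 ** y^-1) ** (zpow t (m * j))^-1).
      split; [apply Conj, Ey|]. unfold x. grp. }
  split; auto. exists G', H0.
  split; [auto|split; [|split; [auto|split; [now intros x []|split; [|split; [|split]]]]]].
  - apply finite_index_in_of_vset; auto.
    apply finite_vset_trans with C0; auto. apply finite_vset_trans with C; auto.
    apply finite_vset_weaken with (inter C C0); [now intros x []|]. apply C0_index; auto.
  - apply finite_index_in_of_vset; auto. intros; mem.
  - intros h Hh. exists 0%Z, h. split; auto. rewrite Z.mul_0_r; simpl; grp.
  - intros x g Hx [j [h [Hh ->]]].
    assert (Q := Conj (- j)%Z (h^-1 ** x ** h) ltac:(mem)).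
    refine (eq_ind _ H0 Q _ _). rewrite Z.mul_opp_r, zpow_opp. grp.
  (* On [G'] the flux takes exactly the multiples of [m p], so this division is exact. *)
  - exists (fun x => (flux x / (m * p))%Z). split; [|split].
    + intros x y [j [h [Hh ->]]] [j' [h' [Hh' ->]]].
      destruct (H0_fluxless h Hh) as [C0h _]. destruct (H0_fluxless h' Hh') as [C0h' _].
      assert (T1 := Tk (m * j)%Z). assert (T2 := Tk (m * j')%Z).
      rewrite (flux_mul (h ** _)), !FluxG by mem.
      rewrite <- Z.mul_add_distr_r, !Z.div_mul by nia. reflexivity.
    + intros z. exists (gone ** zpow t (m * z)). split; [exists z, gone; split; [mem|auto]|].
      rewrite FluxG by mem. apply Z.div_mul. nia.
    + intros x [j [h [Hh ->]]]. rewrite FluxG, Z.div_mul by (auto; nia). split.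
      * intros ->. rewrite Z.mul_0_r; simpl. now rewrite gone_r.
      * intros Q. apply H0_fluxless in Q as [_ Q]. rewrite FluxG in Q by auto. nia.
Qed.

End Lines.

Theorem theorem1p1 (G : Group) (S : list G) (H : G -> Prop) :
  generates S ->
  is_subgroup H ->
  fin_gen_subgroup H ->
  narrow H S ->
  at_least_two_ends H S ->
  (virtual_fiber H <-> separable H) /\
  (separable H <-> bounded_packing H S) /\
  (bounded_packing H S <-> infinitely_many_dcosets H).
Proof.
  intros HS HH FH Hnar Hends.
  (* An end contains infinitely many vertices, so [H] has infinite index. *)
  assert (Hinf : ~ finite_vset H (fun _ => True)).
  { destruct Hends as [K [u [v [_ [_ [_ [Iu _]]]]]]]. intros F. apply Iu.
    now apply finite_vset_sub with (Z' := fun _ => True). }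
  assert (I12 := separable_of_virtual_fiber HH).
  assert (I23 := bounded_packing_of_separable HH S).
  assert (I34 := infinitely_many_dcosets_of_bounded_packing HH S HS Hinf).
  assert (I41 : infinitely_many_dcosets H -> virtual_fiber H).
  { intros Hd.
    assert (HC := comm_subgroup HH). assert (HHC := comm_of_mem HH).
    assert (Ccomm : forall c, comm (H := H) c -> half_comm (H := H) c) by now intros c [].
    assert (FC := finite_index_of_infinite HS HH Hnar HC HHC (comm_infinite HS HH Hnar FH Hd)).
    destruct (translation_exists HS HH FH comm HC Ccomm HHC FC Hends) as [t [Ct tH]].
    destruct (narrow_dcosets HS HH Hnar (zpowers t) (comm (H := H))) as [xs [Cxs [Dxs Cov]]];
      auto using zpowers_subgroup, zpowers_fin_gen.
    { intros c Hc. now apply (line_infinite HH HC Ccomm tH). }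
    now apply (virtual_fiber_of_lines HH HC HHC Ccomm Ct tH Cxs Dxs Cov). }
  tauto.
Qed.
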